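(* Let $1\le M\le n$, and let $\underline{s}\in\mathbb{R}^n$ with $s_i>-\frac32$ for $i\neq M$ and $s_M>-1$; put $s_0=s_{n+1}=0$. Let $\theta\in Q_{A_n}$ and let $Y$ be a $P_{A_n}$-valued random variable with the Wishart law $\tilde\gamma^{(M)}_{\underline{s},\theta}$. Let $x^{(1)},\dots,x^{(N)}\in I_G$, $G=A_n$. Then, denoting by $C(\pi)$ the set of cycles of a permutation $\pi\in S_N$, the $N$-th moment $\mathbf{E}(\langle Y,x^{(1)}\rangle\cdots\langle Y,x^{(N)}\rangle)$ equals $$\sum_{\pi\in S_N}\prod_{c\in C(\pi)}\Bigl\{\sum_{i=1}^{M-1}(s_i+\tfrac32)\,\mathrm{tr}\prod_{j\in c}(\theta_{\{i:i+1\}})^{-1}x^{(j)}_{\{i:i+1\}}+\sum_{i=M}^{n-1}(s_{i+1}+\tfrac32)\,\mathrm{tr}\prod_{j\in c}(\theta_{\{i:i+1\}})^{-1}x^{(j)}_{\{i:i+1\}}$$ $$-\sum_{i=2}^{M-1}(s_{i-1}+1)\theta_{ii}^{-|c|}\prod_{j\in c}x^{(j)}_{ii}-(s_{M-1}-s_M+s_{M+1}+1)\theta_{MM}^{-|c|}\prod_{j\in c}x^{(j)}_{MM}-\sum_{i=M+1}^{n-1}(s_{i+1}+1)\theta_{ii}^{-|c|}\prod_{j\in c}x^{(j)}_{ii}\Bigr\}.$$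
   Context: $G=A_n$ is the path graph $1-2-\cdots-n$ on $V=\{1,\dots,n\}$; $E=\{(i,j): |i-j|\le 1\}$. $Z_G$ is the space of real symmetric $n\times n$ matrices $y$ with $y_{ij}=0$ if $(i,j)\notin E$; $P_{A_n}=P_G$ is the set of positive definite $y\in Z_G$. $I_G$ is the dual space of $Z_G$, realised as the space of incomplete symmetric matrices $x=(x_{ij})_{(i,j)\in E}$, with $\langle x,y\rangle=\langle y,x\rangle=\mathrm{tr}(yx)=\sum_{(i,j)\in E}y_{ij}x_{ij}$. $Q_{A_n}=Q_G=\{x\in I_G:\langle x,y\rangle>0\ \forall y\in\overline{P_G}\setminus\{0\}\}$. $dy$ is Lebesgue measure on $Z_G$. For $I\subset V$, a subscript $I$ denotes the submatrix with rows and columns in $I$; $\{i:j\}=\{i,\dots,j\}$; for a matrix, $|\cdot|$ is the determinant. Empty sums are $0$ and empty products are $1$. $$\Delta^{(M)}_{\underline{s}}(y)=\prod_{i=1}^{M-1}|y_{\{1:i\}}|^{s_i-s_{i+1}}\;|y|^{s_M}\prod_{i=M+1}^{n}|y_{\{i:n\}}|^{s_i-s_{i-1}},\qquad y\in P_G.$$ The Wishart law $\tilde\gamma^{(M)}_{\underline{s},\theta}$ on $P_G$ is the probability measure with density proportional to $e^{-\langle\theta,y\rangle}\Delta^{(M)}_{\underline{s}}(y)$ with respect to $dy$ on $P_G$. $N\ge1$ is an integer and $S_N$ is the symmetric group on $\{1,\dots,N\}$. Cycles include fixed points; $|c|$ is the length of the cycle $c$. For a cycle $c=(j_1\,j_2\cdots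 j_k)$ the product $\prod_{j\in c}B_j$ of matrices means $B_{j_1}B_{j_2}\cdots B_{j_k}$ in the cyclic order of $c$ (its trace does not depend on the starting point).
   Formalization: The boundary convention s_0 = s_{n+1} = 0 is replaced by s_0 = s_{n+1} = -1; with 0 the formula fails for M = 1 or M = n (for n = M = N = 1 it gives (s_1-1)x/θ, but the gamma mean is (s_1+1)x/θ). Nothing changes for 1 < M < n. *)

(* Defs.v *)
From HB Require Import structures.
From mathcomp Require Import all_boot all_order all_algebra all_fingroup.
From mathcomp Require Import all_classical all_reals all_analysis.

Set Implicit Arguments.
Unset Strict Implicit.
Unset Printing Implicit Defensive.

Import Order.TTheory GRing.Theory Num.Theory.
Import numFieldNormedType.Exports.

Local Open Scope classical_set_scope.
Local Open Scope ring_scope.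

(* As for n.-tuple T in the library, matrices carry the sigma-algebra
   generated by their entries; over the reals it is the Borel one. *)
Definition mx_display : measure_display -> measure_display.
Proof. by []. Qed.

Section MxMeasurable.
Context {d} {T : measurableType d} (m n : nat).

Definition mx_entry_sets : set (set 'M[T]_(m, n)) :=
  <<s \bigcup_i \bigcup_j
        preimage_set_system setT (fun A : 'M[T]_(m, n) => A i j) measurable >>.

Let mx_set0 : mx_entry_sets set0.
Proof. exact: sigma_algebra0. Qed.

Let mx_setC A : mx_entry_sets A -> mx_entry_sets (~` A).
Proof. exact: sigma_algebraC. Qed.

Let mx_bigcup (F : _^nat) :
  (forall k, mx_entry_sets (F k)) -> mx_entry_sets (\bigcup_k F k).
Proof. exact: sigma_algebra_bigcup. Qed.

HB.instance Definition _ := @isMeasurable.Build (mx_display d)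
  'M[T]_(m, n) mx_entry_sets mx_set0 mx_setC mx_bigcup.

End MxMeasurable.

Lemma measurable_mxP d1 d2 (T1 : measurableType d1) (T2 : measurableType d2)
    (m n : nat) (f : T1 -> 'M[T2]_(m, n)) :
  (forall i j, measurable_fun setT (fun t => f t i j)) ->
  measurable_fun setT f.
Proof.
move=> mf; apply: (@measurability _ _ _ _ _ _ (\bigcup_i \bigcup_j
  preimage_set_system setT (fun A : 'M[T2]_(m, n) => A i j) measurable)) => //.
move=> _ [B [i _ [j _ [C mC <-]]] <-].
rewrite !setTI; have := mf i j measurableT C mC; by rewrite setTI.
Qed.

Section LebesgueTuple.
Context {R : realType}.
Local Notation Rm := (measurableTypeR R).

Section Step.
Context {n : nat} (mu : {sigma_finite_measure set n.-tuple Rm -> \bar R}).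

Let consp (p : Rm * n.-tuple Rm) : n.+1.-tuple Rm := [tuple of p.1 :: p.2].

Let measurable_consp : measurable_fun setT consp.
Proof. exact: measurable_cons. Qed.

Definition lebesgue_tupleS : set (n.+1.-tuple Rm) -> \bar R :=
  pushforward (lebesgue_measure \x mu)%E
    (fun p : Rm * n.-tuple Rm => [tuple of p.1 :: p.2]).

Let lebesgue_tupleS0 : lebesgue_tupleS set0 = 0%E.
Proof. by rewrite /lebesgue_tupleS measure0. Qed.

Let lebesgue_tupleS_ge0 A : (0 <= lebesgue_tupleS A)%E.
Proof. exact: measure_ge0. Qed.

Let lebesgue_tupleS_sigma_additive : semi_sigma_additive lebesgue_tupleS.
Proof. by apply: measure_semi_sigma_additive; exact: measurable_consp. Qed.

HB.instance Definition _ := isMeasure.Build _ _ _ lebesgue_tupleS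
  lebesgue_tupleS0 lebesgue_tupleS_ge0 lebesgue_tupleS_sigma_additive.

Let lebesgue_tupleS_sigma_finite : sigma_finite setT lebesgue_tupleS.
Proof.
have [F TF Foo] : sigma_finite setT (lebesgue_measure \x mu)%E.
  have /sigma_finiteP[F [TF ndF Foo]] := sigma_finiteT (@lebesgue_measure R).
  have /sigma_finiteP[G [TG ndG Goo]] := sigma_finiteT mu.
  exists (fun k => F k `*` G k).
    rewrite -setXTT TF TG predeqE => -[a t]; split.
      move=> [/= [k _ Fka] [l _ Glt]]; exists (maxn k l) => //; split.
      - by move: a Fka; exact/subsetPset/ndF/leq_maxl.
      - by move: t Glt; exact/subsetPset/ndG/leq_maxr.
    by move=> [k _ []/= ? ?]; split; exists k.
  move=> k; have [? ?] := Foo k; have [? ?] := Goo k.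
  split; first exact: measurableX.
  by rewrite product_measure1E// lte_mul_pinfty// ge0_fin_numE.
pose uncons (t : n.+1.-tuple Rm) : Rm * n.-tuple Rm :=
  (thead t, [tuple of behead t]).
have consK : cancel consp uncons.
  move=> [a t]; rewrite /uncons /consp theadE; congr pair; exact/val_inj.
have unconsK : cancel uncons consp by move=> t; rewrite [RHS]tuple_eta.
have muncons : measurable_fun setT uncons.
  apply: measurable_fun_pair; last exact: measurable_behead.
  exact: measurable_tnth.
exists (fun k => uncons @^-1` F k).
  by rewrite -preimage_bigcup -TF preimage_setT.
move=> k; have [mFk Fkoo] := Foo k; split.
  by rewrite -[X in measurable X]setTI; exact: muncons.
rewrite /lebesgue_tupleS /pushforward -comp_preimage.
by rewrite (_ : _ \o _ = id)//; apply/funext => p; exact: consK.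
Qed.

HB.instance Definition _ := Measure_isSigmaFinite.Build _ _ _ lebesgue_tupleS
  lebesgue_tupleS_sigma_finite.

End Step.

Fixpoint lebesgue_tuple (n : nat) :
    {sigma_finite_measure set n.-tuple Rm -> \bar R} :=
  if n is k.+1 then lebesgue_tupleS (lebesgue_tuple k) else \d_[tuple].

End LebesgueTuple.

Section PathGraph.
Context {R : realType} {n : nat}.
Implicit Types (x y theta : 'M[R]_n) (s : 'rV[R]_n).

(* Vertices 1, ..., n are the ordinals 0, ..., n-1. *)
Definition adj (i j : 'I_n) : bool := (i <= j.+1)%N && (j <= i.+1)%N.

Definition Z_G : set 'M[R]_n :=
  [set y | y^T = y /\ forall i j, ~~ adj i j -> y i j = 0].

Definition P_G : set 'M[R]_n :=
  [set y | Z_G y /\ forall v : 'rV[R]_n, v != 0 -> 0 < (v *m y *m v^T) 0 0].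

(* An incomplete symmetric matrix is stored with 0 in the unspecified
   positions; none of the definitions below looks at these positions. *)
Definition I_G : set 'M[R]_n :=
  [set x | x^T = x /\ forall i j, ~~ adj i j -> x i j = 0].

Definition pairing x y : R := \sum_i \sum_(j | adj i j) y i j * x i j.

Definition Q_G : set 'M[R]_n :=
  [set x | I_G x /\ forall y, closure P_G y -> y != 0 -> 0 < pairing x y].

(* Coordinates on Z_G: diagonal entries p.1, entries (i, i+1) p.2. *)
Definition band_mx (p : n.-tuple (measurableTypeR R) * n.-1.-tuple (measurableTypeR R)) : 'M[R]_n :=
  \matrix_(i, j) if i == j then tnth p.1 i
                 else if adj i j then nth 0 p.2 (minn i j) else 0.

Lemma measurable_band_mx : measurable_fun setT band_mx.
Proof.
apply: measurable_mxP => i j.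
under eq_fun do rewrite mxE.
case: (i == j).
  exact: measurableT_comp (@measurable_tnth _ (measurableTypeR R) n i)
    measurable_fst.
case: (adj i j); last exact: measurable_cst.
have [lt_ij|le_ij] := ltnP (minn i j) n.-1; last first.
  rewrite (_ : (fun _ => _) = cst 0); first exact: measurable_cst.
  by apply/funext => p; rewrite nth_default// size_tuple.
under eq_fun do rewrite -(tnth_nth 0 _ (Ordinal lt_ij)).
exact: measurableT_comp
  (@measurable_tnth _ (measurableTypeR R) _ (Ordinal lt_ij)) measurable_snd.
Qed.

Definition lebesgue_Z : set 'M[R]_n -> \bar R :=
  pushforward (lebesgue_tuple n \x lebesgue_tuple n.-1)%E band_mx.

Let lebesgue_Z0 : lebesgue_Z set0 = 0%E.
Proof. by rewrite /lebesgue_Z /pushforward preimage_set0 measure0. Qed.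

Let lebesgue_Z_ge0 A : (0 <= lebesgue_Z A)%E.
Proof. by rewrite /lebesgue_Z /pushforward measure_ge0. Qed.

Let lebesgue_Z_sigma_additive : semi_sigma_additive lebesgue_Z.
Proof. by apply: measure_semi_sigma_additive; exact: measurable_band_mx. Qed.

HB.instance Definition _ := isMeasure.Build _ _ _ lebesgue_Z
  lebesgue_Z0 lebesgue_Z_ge0 lebesgue_Z_sigma_additive.

(* 1-based entry, and contiguous k x k principal submatrix with first index
   i, so that A_{i:j} is [blk A i (j - i + 1)]; meant for 1 <= i, j <= n. *)
Definition ent (A : 'M[R]_n) (i j : nat) : R :=
  if (insub i.-1, insub j.-1) is (Some a, Some b) then A a b else 0.

Definition blk (A : 'M[R]_n) (i k : nat) : 'M[R]_k :=
  \matrix_(a, b) ent A (i + a) (i + b).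

(* s_i for 1 <= i <= n, with s_0 = s_(n+1) = -1.  The boundary values enter
   the moment formula only through s_(M-1) - s_M + s_(M+1) + 1 when M = 1 or
   M = n.  They must be -1: for n = M = 1 the law is the gamma law
   proportional to y^(s_1) e^(-theta y), of mean (s_1 + 1) / theta. *)
Definition sidx s (i : nat) : R :=
  if i is k.+1 then (if insub k is Some a then s 0 a else -1) else -1.

Definition Delta (M : nat) s y : R :=
  (\prod_(1 <= i < M) \det (blk y 1 i) `^ (sidx s i - sidx s i.+1))
  * \det y `^ sidx s M
  * \prod_(M.+1 <= i < n.+1)
      \det (blk y i (n.+1 - i)) `^ (sidx s i - sidx s i.-1).

Definition wishart_law (M : nat) s theta (mu : probability 'M[R]_n R) : Prop :=
  exists2 c : R, 0 < c & forall A, measurable A ->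
    mu A = (c%:E * \int[lebesgue_Z]_(y in A `&` P_G)
                     (expR (- pairing theta y) * Delta M s y)%:E)%E.

End PathGraph.

(* The cycle c of pi listed in cyclic order, from an arbitrary element. *)
Definition cycle_seq (N : nat) (pi : 'S_N) (c : {set 'I_N}) : seq 'I_N :=
  if [pick j in c] is Some j then traject pi j #|c| else [::].

(* Main.v *)
Require Import Defs.
From HB Require Import structures.
From mathcomp Require Import all_boot all_order all_algebra all_fingroup.
From mathcomp Require Import all_classical all_reals all_analysis.
From mathcomp Require Import ring lra zify.
From mathcomp Require Import measurable_realfun.

(** The theorem is the product of two facts: the Laplace transform of the
Wishart law is explicit, and it is a product of powers of determinants, whose
repeated derivatives are indexed by permutations.

Laplace transform.  Let [L theta] be the integral of exp(- <theta, y>) Delta(y)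
over P_G.  Suppose that the root M is not the first vertex, and eliminate that
vertex: with y'_22 = y_22 - y_12^2 / y_11, each minor on {1..i} is y_11 times
the minor of y' on {2..i}, so that the exponents s_i - s_(i+1) of y_11 add up to
s_1, and the rest of Delta is the same function on the shorter path
([band_weight_peel]).  The translation from y_22 to y'_22 removes y_11 and y_12
from this rest; what is left is a Gaussian integral in y_12 and a gamma integral
in y_11, of value a constant times
(theta_11 theta_22 - theta_12^2)^(-(s_1 + 3/2)) theta_22^(s_1 + 1).
Once the root is the first vertex, the quotients q_i of the minor on {i..n} by
the minor on {i+1..n} satisfy q_i = y_ii - y_(i,i+1)^2 / q_(i+1), and Delta is
the product of the q_i^(s_i) ([band_weight_root0]).  Integrating the first
vertex and the first edge while the other entries are fixed multiplies the gamma
factor of q_2 by another gamma factor, and one recurses.  Altogether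
([band_integral_weight]) L is a constant times powers of the 2 x 2 determinants
and of the diagonal entries of theta, for all theta with positive 2 x 2 blocks;
membership in Q_G is tested on rank-one matrices carried by one edge to see that
the blocks are positive ([Q_G_edge_pos]).  The constant is fixed by L(theta0)
being the total mass ([wishart_laplace]).

Moments.  The logarithmic derivative of D = 1 / det(theta) in the direction x is
- tr(theta^-1 x), and the derivative of a word
tr(theta^-1 x_1 ... theta^-1 x_k) is minus the sum of the words where x is
inserted at one of the k places.  A pair (D, k) with these two properties is
called [cumulants]; such pairs are stable under products and real powers, where
k becomes a sum and a multiple.  This is where the braces of the moment formula
come from.  Differentiating D times the sum over S_N of the products of
k(cycle) adds one letter: as a new fixed point when D is differentiated, inside
a cycle when k is.  Every permutation of N + 1 letters arises exactly once in
this way ([perm_sum_recl]), so the N-th derivative is the sum over S_N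
([moment_perm_sum]); differentiation under the integral sign is dominated by the
values at the two ends of a small segment in the open domain of theta. *)

Set Implicit Arguments.
Unset Strict Implicit.
Unset Printing Implicit Defensive.

Import Order.TTheory GRing.Theory Num.Theory.
Import numFieldNormedType.Exports.

Local Open Scope classical_set_scope.
Local Open Scope ring_scope.

(** * Cycles of a permutation and insertion of a letter *)
Section Orbits.
Variable (T : finType).
Implicit Types (s : {perm T}) (x : T).

Lemma porbit_iter s x m : (0 < m)%N -> iter m s x = x ->
  porbit s x = [set z in traject s x m].
Proof.
move=> m0 mx; apply/setP => z; rewrite inE; apply/porbitP/trajectP.
- move=> [i ->]; exists (i %% m)%N; first by rewrite ltn_mod.
  rewrite permX {1}(divn_eq i m) addnC iterD; congr (iter _ _ _).
  by elim: (i %/ m)%N => [//|k IH]; rewrite mulSn addnC iterD mx IH.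
- by move=> [i _ ->]; exists i; rewrite permX.
Qed.

(** Changing the starting point of a cycle rotates the word it spells. *)
Lemma rot_traject s x m p : iter m s x = x -> (p <= m)%N ->
  rot p (traject s x m) = traject s (iter p s x) m.
Proof.
move=> mx pm; have mE : m = (p + (m - p))%N by rewrite subnKC.
rewrite {1}mE trajectD -{1}(size_traject s x p) rot_size_cat.
rewrite [in RHS]mE addnC trajectD -iterD subnK //.
by rewrite mx.
Qed.

Lemma porbits_memE s (c : {set T}) x : c \in porbits s ->
  (x \in c) = (porbit s x == c).
Proof. by move=> /imsetP[k _ ->]; rewrite eq_porbit_mem. Qed.

End Orbits.

Lemma cycle_seqE (N : nat) (s : 'S_N) (c : {set 'I_N}) : c \in porbits s ->
  exists2 j, j \in c & cycle_seq s c = traject s j #|c|.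
Proof.
move=> /imsetP[k _ ->]; rewrite /cycle_seq.
case: pickP => [j jk|/(_ k)]; last by rewrite porbit_id.
by exists j.
Qed.

Section Insertion.
Variable N : nat.
Implicit Types (s : 'S_N).

(** The letter 0 is inserted just before j in its cycle, or becomes a fixed point
when j = 0; the other letters are shifted by one. *)
Definition insert_perm s (j : 'I_N.+1) : 'S_N.+1 :=
  (lift_perm ord0 ord0 s * tperm ord0 j)%g.

Lemma insert_perm0 s j : insert_perm s j ord0 = j.
Proof. by rewrite permM lift_perm_id tpermL. Qed.

Lemma insert_perm_fix s k :
  insert_perm s ord0 (lift ord0 k) = lift ord0 (s k).
Proof. by rewrite permM lift_perm_lift tperm1 perm1. Qed.

Lemma insert_perm_lift s j k : insert_perm s (lift ord0 j) (lift ord0 k) =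
  if s k == j then ord0 else lift ord0 (s k).
Proof.
rewrite permM lift_perm_lift; case: eqVneq => [->|ne]; first by rewrite tpermR.
by rewrite tpermD// ?neq_lift// (inj_eq lift_inj) eq_sym.
Qed.

(** The image of 0 recovers j, hence s; a count of both sides finishes. *)
Lemma insert_perm_bij : bijective (fun p : 'S_N * 'I_N.+1 => insert_perm p.1 p.2).
Proof.
apply: inj_card_bij.
  move=> [s j] [s' j'] /= E.
  have jE : j = j' by rewrite -(insert_perm0 s j) E insert_perm0.
  rewrite -jE in E *; congr pair; apply/permP => k.
  have /permP/(_ (lift ord0 k)) := mulIg _ _ _ E.
  by rewrite !lift_perm_lift => /lift_inj.
by rewrite card_prod !card_Sn card_ord mulnC.
Qed.

(** C collects the cycles of s absorbed by the cycle of 0: none when 0 is fixed,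
one when 0 is inserted in it. *)
Lemma porbits_insert s (p : 'S_N.+1) (C : {set {set 'I_N}}) :
  (forall k, porbit s k \notin C ->
     porbit p (lift ord0 k) = lift ord0 @: porbit s k) ->
  (forall k, porbit s k \in C -> lift ord0 k \in porbit p ord0) ->
  porbits p = porbit p ord0 |:
    [set lift ord0 @: c | c : {set 'I_N} in porbits s :\: C].
Proof.
move=> out inn; apply/setP => c; rewrite !inE.
apply/imsetP/orP => [[k _ ->]|[/eqP ->|]]; last 2 first.
- by exists ord0.
- move=> /imsetP[b /setDP[/imsetP[k _ ->] kC] ->].
  by exists (lift ord0 k) => //; rewrite out.
case: (unliftP ord0 k) => [k'|] ->; last by left.
have [kC|kC] := boolP (porbit s k' \in C).
  by left; rewrite eq_porbit_mem inn.
by right; apply/imsetP; exists (porbit s k'); rewrite ?inE ?kC ?imset_f ?out.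
Qed.

End Insertion.

Section PermSum.
Variables (R : comNzRingType) (L : Type) (k : seq L -> R).
Hypothesis k_cyclic : forall u v, k (u ++ v) = k (v ++ u).

Definition perm_sum (N : nat) (y : 'I_N -> L) : R :=
  \sum_(s : 'S_N) \prod_(c in porbits s) k [seq y j | j <- cycle_seq s c].

Lemma perm_sum0 (y : 'I_0 -> L) : perm_sum y = 1.
Proof.
rewrite /perm_sum (big_pred1 1%g) => [|s]; last first.
  by apply/esym/eqP/permP => -[].
by rewrite big_pred0// => c; apply/negP => /imsetP[[]].
Qed.

Lemma cyclic_rot p u : k (rot p u) = k u.
Proof. by rewrite /rot k_cyclic cat_take_drop. Qed.

Lemma cycle_value N (y : 'I_N -> L) (s : 'S_N) x :
  k [seq y j | j <- cycle_seq s (porbit s x)] =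
  k [seq y j | j <- traject s x #|porbit s x|].
Proof.
have [|j jx ->] := @cycle_seqE _ s (porbit s x); first exact: imset_f.
move: jx; rewrite porbit_traject => /trajectP[p pm ->].
by rewrite -rot_traject ?iter_porbit// 1?ltnW// map_rot cyclic_rot.
Qed.

Section Step.
Variables (N : nat) (y : 'I_N.+1 -> L).
Let y' (j : 'I_N) := y (lift ord0 j).
Implicit Types (s : 'S_N).

Let iter_insert s j i x :
  (forall a, (a < i)%N -> iter a.+1 s x != j) ->
  iter i (insert_perm s (lift ord0 j)) (lift ord0 x) = lift ord0 (iter i s x).
Proof.
elim: i => [//|i IH] H /=; rewrite IH ?insert_perm_lift.
  by rewrite -iterS (negPf (H _ _)).
by move=> a ai; apply: H; rewrite ltnW.
Qed.

Let traject_insert s j i x :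
  (forall a, (a < i)%N -> iter a.+1 s x != j) ->
  traject (insert_perm s (lift ord0 j)) (lift ord0 x) i.+1 =
  map (lift ord0) (traject s x i.+1).
Proof.
move=> H; apply: (@eq_from_nth _ ord0); first by rewrite size_map !size_traject.
move=> a; rewrite size_traject => ai.
rewrite (set_nth_default (lift ord0 x)) ?size_traject// nth_traject//.
rewrite (nth_map x) ?size_traject// nth_traject// iter_insert// => b ba.
by apply: H; apply: leq_trans ba _.
Qed.

Let porbit_cardS (T : finType) (s : {perm T}) x : {m | #|porbit s x| = m.+1}.
Proof.
have := card_porbit_neq0 s x; case: #|_| => // m _; by exists m.
Qed.

(** The letter before which 0 is inserted comes back only at the end of its
cycle, so up to there the new cycle follows the old one. *)
Let no_return s j i m : #|porbit s j| = m.+1 -> (i < m)%N -> iter i.+1 s j != j.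
Proof.
move=> mE im; have := uniq_traject_porbit s j; rewrite mE /= => /andP[+ _].
by apply: contra => /eqP E; apply/trajectP; exists i => //; rewrite -iterSr iterS E.
Qed.

Let traject_insert_orbit s j :
  traject (insert_perm s (lift ord0 j)) ord0 #|porbit s j|.+1 =
  ord0 :: map (lift ord0) (traject s j #|porbit s j|).
Proof.
have [m mE] := porbit_cardS s j.
rewrite trajectS insert_perm0 mE traject_insert// => a am.
exact: no_return mE am.
Qed.

Let iter_insert_orbit s j :
  iter #|porbit s j|.+1 (insert_perm s (lift ord0 j)) ord0 = ord0.
Proof.
have [m mE] := porbit_cardS s j.
have E := iter_porbit s j; rewrite mE in E.
rewrite mE iterSr insert_perm0 iterS iter_insert; last first.
  by move=> a am; exact: no_return mE am.
by rewrite insert_perm_lift -iterS E eqxx.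
Qed.

Let porbit_insert s j : porbit (insert_perm s (lift ord0 j)) ord0 =
  ord0 |: lift ord0 @: porbit s j.
Proof.
rewrite (porbit_iter _ (iter_insert_orbit s j))//; apply/setP => z.
rewrite traject_insert_orbit !inE; congr orb.
apply/mapP/imsetP => -[x xs ->]; exists x => //.
  by rewrite porbit_traject.
by rewrite -porbit_traject.
Qed.

Let porbit_insert_out s j x : porbit s x != porbit s j ->
  traject (insert_perm s (lift ord0 j)) (lift ord0 x) #|porbit s x| =
    map (lift ord0) (traject s x #|porbit s x|) /\
  porbit (insert_perm s (lift ord0 j)) (lift ord0 x) =
    lift ord0 @: porbit s x.
Proof.
rewrite eq_porbit_mem => xj.
have ne a : iter a s x != j.
  by apply: contra xj => /eqP <-; rewrite -permX porbit_sym mem_porbit.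
have [m mE] := porbit_cardS s x.
have tE : traject (insert_perm s (lift ord0 j)) (lift ord0 x) #|porbit s x| =
    map (lift ord0) (traject s x #|porbit s x|).
  by rewrite mE traject_insert.
split=> //; have /porbit_iter-> : iter #|porbit s x|
    (insert_perm s (lift ord0 j)) (lift ord0 x) = lift ord0 x.
- by rewrite iter_insert ?iter_porbit.
- apply/setP => z; rewrite inE tE.
  apply/mapP/imsetP => -[t ts ->]; exists t => //.
    by rewrite porbit_traject.
  by rewrite -porbit_traject.
- by rewrite mE.
Qed.

Let iter_fix s i x :
  iter i (insert_perm s ord0) (lift ord0 x) = lift ord0 (iter i s x).
Proof. by elim: i => //= i ->; rewrite insert_perm_fix. Qed.

Let traject_fix s x i :
  traject (insert_perm s ord0) (lift ord0 x) i =
  map (lift ord0) (traject s x i).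
Proof.
by elim: i x => //= i IH x; rewrite insert_perm_fix IH.
Qed.

Let porbit_fix s x : porbit (insert_perm s ord0) (lift ord0 x) =
    lift ord0 @: porbit s x.
Proof.
have [m mE] := porbit_cardS s x.
rewrite (@porbit_iter _ _ _ #|porbit s x|) ?iter_fix ?iter_porbit ?mE//.
apply/setP => z; rewrite inE traject_fix -mE.
apply/mapP/imsetP => -[t ts ->]; exists t => //.
  by rewrite porbit_traject.
by rewrite -porbit_traject.
Qed.

Let prod_insert s (p : 'S_N.+1) (C : {set {set 'I_N}}) :
  (forall x, porbit s x \notin C ->
    traject p (lift ord0 x) #|porbit s x| =
      map (lift ord0) (traject s x #|porbit s x|) /\
    porbit p (lift ord0 x) = lift ord0 @: porbit s x) ->
  (forall x, porbit s x \in C -> lift ord0 x \in porbit p ord0) ->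
  \prod_(c in porbits p) k [seq y j | j <- cycle_seq p c] =
  k [seq y j | j <- traject p ord0 #|porbit p ord0|] *
  \prod_(c in porbits s :\: C) k [seq y' j | j <- cycle_seq s c].
Proof.
move=> out inn; rewrite (porbits_insert (fun x h => proj2 (out x h)) inn).
rewrite big_setU1/=; last first.
  apply/negP => /imsetP[b _ E]; have := porbit_id p ord0.
  by rewrite E => /imsetP[x _] /eqP; rewrite (negPf (neq_lift _ _)).
rewrite cycle_value big_imset/=; last by move=> a b _ _; apply/imset_inj/lift_inj.
congr (_ * _); apply: eq_bigr => _ /setDP[/imsetP[x _ ->] xC].
have [tE pE] := out x xC.
rewrite -pE !cycle_value pE card_imset; last exact: lift_inj.
by rewrite tE -map_comp.
Qed.

(** The Leibniz rule for the sum over permutations, before any derivative is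
taken.  For s fixed, the insertion points j of the letter 0 are sorted by the
cycle of s that contains them; invariance of [k] under rotation lets every
cycle be read from 0. *)
Lemma perm_sum_recl : perm_sum y = \sum_(s : 'S_N)
  (k [:: y ord0] * \prod_(c in porbits s) k [seq y' j | j <- cycle_seq s c] +
   \sum_(c in porbits s)
     (\sum_(p < size (cycle_seq s c))
        k (y ord0 :: rot p [seq y' j | j <- cycle_seq s c])) *
     \prod_(b in porbits s | b != c) k [seq y' j | j <- cycle_seq s b]).
Proof.
rewrite /perm_sum (reindex _ (onW_bij _ (@insert_perm_bij N))) /=.
rewrite -(pair_bigA _ (fun s j => \prod_(c in porbits (insert_perm s j))
  k [seq y j0 | j0 <- cycle_seq (insert_perm s j) c])) /=.
apply: eq_bigr => s _; rewrite big_ord_recl; congr (_ + _).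
- rewrite (@prod_insert s _ finset.set0); first last.
  + by move=> x; rewrite inE.
  + by move=> x _; rewrite traject_fix porbit_fix.
(* the new letter is a fixed point: its orbit is the one-letter trajectory *)
  rewrite finset.setD0 (@porbit_iter _ _ _ 1)//=; last by rewrite insert_perm0.
  by rewrite (_ : #|_| = 1%N)// -(cards1 (@ord0 N)); apply: eq_card => z; rewrite !inE.
rewrite (partition_big (porbit s) (fun c => c \in porbits s)) => [|j _]; last exact: imset_f.
apply: eq_bigr => c cs.
transitivity ((\sum_(j in c) k (y ord0 :: [seq y' i | i <- traject s j #|c|])) *
   \prod_(b in porbits s | b != c) k [seq y' j | j <- cycle_seq s b]).
  rewrite mulr_suml (eq_bigl (fun j => j \in c)) => [|j]; last first.
    by rewrite (porbits_memE _ cs).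
  apply: eq_bigr => j; rewrite (porbits_memE _ cs) => /eqP cE.
  rewrite (@prod_insert s _ [set c]); first last.
  + move=> x; rewrite inE -cE => /eqP xj; rewrite porbit_insert !inE.
    by apply/orP; right; apply: imset_f; rewrite -xj porbit_id.
  + by move=> x; rewrite inE -cE; exact: porbit_insert_out.
  rewrite porbit_insert cardsU1 card_imset; last exact: lift_inj.
  rewrite (_ : _ \notin _); last first.
    by apply/negP => /imsetP[x _ /eqP]; rewrite (negPf (neq_lift _ _)).
  rewrite [(true + _)%N]add1n traject_insert_orbit cE /= -map_comp; congr (_ * _).
  by apply: eq_bigl => b; rewrite !inE andbC.
congr (_ * _); have [j0 j0c wE] := cycle_seqE cs.
have cE : porbit s j0 = c by apply/eqP; rewrite -(porbits_memE _ cs).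
have := uniq_traject_porbit s j0; rewrite cE -wE => wu.
have wc : cycle_seq s c =i c by move=> x; rewrite wE -cE porbit_traject.
rewrite -(eq_bigl _ _ wc) -big_uniq//= (big_nth j0) big_mkord.
apply: eq_bigr => p _; rewrite -map_rot; congr (k (_ :: map _ _)).
have pm : (p < #|c|)%N by rewrite -(size_traject s j0 #|c|) -wE.
move: (nat_of_ord p) pm => {}p pm.
by rewrite wE nth_traject// rot_traject ?(ltnW pm)// -cE iter_porbit.
Qed.

End Step.
End PermSum.

(** * Derivatives along a matrix pencil *)
Section RealDerivative.
Context {R : realType}.
Implicit Types (f g : R -> R) (x a b : R).

Lemma der_val f x a b : a = b -> is_derive x 1 f a -> is_derive x 1 f b.
Proof. by move=> ->. Qed.

Lemma der_cst x (k : R) : is_derive x 1 (fun=> k) 0.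
Proof. exact: is_derive_cst. Qed.

(** The rules of differentiation are restated on expanded functions, so that they
compose by unification. *)
Lemma derD f g x a b : is_derive x 1 f a -> is_derive x 1 g b ->
  is_derive x 1 (fun t => f t + g t) (a + b).
Proof. exact: is_deriveD. Qed.

Lemma derM f g x a b : is_derive x 1 f a -> is_derive x 1 g b ->
  is_derive x 1 (fun t => f t * g t) (a * g x + f x * b).
Proof.
move=> df dg; apply: (der_val (a := f x *: b + g x *: a)).
by rewrite /GRing.scale/= addrC [g x * a]mulrC.
Qed.

Lemma derZ k f x a : is_derive x 1 f a -> is_derive x 1 (fun t => k * f t) (k * a).
Proof. exact: is_deriveZ. Qed.

Lemma derN f x a : is_derive x 1 f a -> is_derive x 1 (fun t => - f t) (- a).
Proof. exact: is_deriveN. Qed.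

Lemma der_sum (I : Type) (r : seq I) (P : pred I) (F : I -> R -> R) (F' : I -> R) x :
  (forall i, P i -> is_derive x 1 (F i) (F' i)) ->
  is_derive x 1 (fun t => \sum_(i <- r | P i) F i t) (\sum_(i <- r | P i) F' i).
Proof.
move=> dF; elim: r => [|i r IH].
  by under eq_fun do rewrite big_nil; rewrite big_nil; exact: der_cst.
under eq_fun do rewrite big_cons; rewrite big_cons.
by case: ifP => // Pi; apply: derD => //; exact: dF.
Qed.

Lemma der_prod (I : eqType) (r : seq I) (P : pred I) (F : I -> R -> R) (F' : I -> R) x :
  uniq r -> (forall i, P i -> is_derive x 1 (F i) (F' i)) ->
  is_derive x 1 (fun t => \prod_(i <- r | P i) F i t)
    (\sum_(i <- r | P i) F' i * \prod_(j <- r | P j && (j != i)) F j x).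
Proof.
move=> + dF; elim: r => [|i r IH] /=.
  by under eq_fun do rewrite big_nil; rewrite big_nil => _; exact: der_cst.
move=> /andP[ir /IH {}IH]; under eq_fun do rewrite big_cons; rewrite big_cons.
have nir j : j \in r -> (i != j) by move=> jr; apply: contraNneq ir => ->.
case: ifP => Pi; last first.
  apply: der_val IH; apply: eq_bigr => j _; congr (_ * _).
  by rewrite [RHS]big_cons Pi.
apply: der_val (derM (dF i Pi) IH); congr (_ + _).
  rewrite [in RHS]big_cons eqxx andbF; congr (_ * _).
  rewrite [LHS]big_seq_cond [RHS]big_seq_cond; apply: eq_bigl => j.
  by case: (boolP (j \in r)) => //= /nir; rewrite eq_sym => ->; rewrite andbT.
rewrite mulr_sumr [LHS]big_seq_cond [RHS]big_seq_cond; apply: eq_bigr => j /andP[jr _].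
by rewrite [in RHS]big_cons Pi nir//= mulrCA.
Qed.

Lemma der_powR f x a p : 0 < f x -> is_derive x 1 f a ->
  is_derive x 1 (fun t => f t `^ p) (p * f x `^ (p - 1) * a).
Proof.
move=> fx df; have dp := is_derive1_powR p fx.
exact: (is_derive1_comp dp df).
Qed.

Lemma der_inv f x a : f x != 0 -> is_derive x 1 f a ->
  is_derive x 1 (fun t => (f t)^-1) (- (f x ^- 2 * a)).
Proof.
move=> fx df; apply: der_val (is_deriveV fx df).
by rewrite /GRing.scale/= mulNr.
Qed.

Lemma der_near f g x a : (\forall t \near x, f t = g t) ->
  is_derive x 1 f a -> is_derive x 1 g a.
Proof. exact: near_eq_is_derive. Qed.

Lemma der_line x (u v : R) : is_derive x 1 (fun t => u + t * v) v.
Proof.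
have d := derD (der_cst x u) (derM (is_derive_id (x : R) (1 : R)) (der_cst x v)).
by apply: der_val d; rewrite mulr0 add0r addr0 mul1r.
Qed.

Lemma der_unique f x a b : is_derive x 1 f a -> is_derive x 1 f b -> a = b.
Proof. by move=> da db; rewrite -(@derive_val _ _ _ _ _ _ _ da) (@derive_val _ _ _ _ _ _ _ db). Qed.

Lemma der_continuous f x a : is_derive x 1 f a -> {for x, continuous f}.
Proof.
move=> [df _]; apply: differentiable_continuous; exact/derivable1_diffP.
Qed.

End RealDerivative.

Section Pencil.
Context {R : realType}.
Implicit Types m : nat.

Definition mx_der m n (F : R -> 'M[R]_(m, n)) (x : R) (A : 'M[R]_(m, n)) :=
  forall i j, is_derive x (1 : R) (fun t => F t i j) (A i j).

Lemma mx_derM m n p (F : R -> 'M[R]_(m, n)) (G : R -> 'M[R]_(n, p)) x A B :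
  mx_der F x A -> mx_der G x B ->
  mx_der (fun t => F t *m G t) x (A *m G x + F x *m B).
Proof.
move=> dF dG i j; under eq_fun do rewrite mxE.
rewrite !mxE -big_split; apply: der_sum => k _; exact: derM.
Qed.

Lemma mx_der_trace m (F : R -> 'M[R]_m) x A : mx_der F x A ->
  is_derive x (1 : R) (fun t => \tr (F t)) (\tr A).
Proof. by move=> dF; apply: der_sum => i _; exact: dF. Qed.

Lemma mx_der_cst m n x (A : 'M[R]_(m, n)) : mx_der (fun=> A) x 0.
Proof. by move=> i j; rewrite mxE; exact: der_cst. Qed.

Lemma mx_der_pencil m n x (A X : 'M[R]_(m, n)) : mx_der (fun t => A + t *: X) x X.
Proof. by move=> i j; under eq_fun do rewrite !mxE; exact: der_line. Qed.

(** Only the existence of the derivative matters here: it makes the cofactors, and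
so the inverse matrix, differentiable entrywise. *)
Lemma derivable_det m (F : R -> 'M[R]_m) x A : mx_der F x A ->
  exists d, is_derive x (1 : R) (fun t => \det (F t)) d.
Proof.
move=> dF; eexists; apply: der_sum => s _; apply: derZ.
apply: der_prod => [|i _]; first exact: index_enum_uniq.
exact: dF.
Qed.

(** In the Leibniz expansion, a non-identity permutation moves two indices, so its
term vanishes to second order at 0. *)
Lemma der_det1 m (B : 'M[R]_m) :
  is_derive (0 : R) (1 : R) (fun t => \det (1%:M + t *: B)) (\tr B).
Proof.
have dF := mx_der_pencil 0 1%:M B.
apply: (der_val (a := \sum_(s : 'S_m) (-1) ^+ s *
  \sum_(i < m) B i (s i) * \prod_(j < m | (j != i)) (1%:M + 0 *: B) j (s j))).
  rewrite (bigD1 1%g)//= [X in _ + X]big1 ?addr0 => [|s s1].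
    rewrite odd_perm1 expr0 mul1r; apply: eq_bigr => i _; rewrite perm1 big1 ?mulr1//.
    by move=> j _; rewrite perm1 !mxE eqxx mul0r addr0.
  rewrite big1 ?mulr0// => i _.
  have [j ji sj] : exists2 j, j != i & s j != j.
    have [k sk] : exists k, s k != k.
      by apply/existsP; rewrite -negb_forall; apply: contra s1 => /forallP H;
        apply/eqP/permP => k; rewrite perm1; apply/eqP.
    have [ki|] := eqVneq k i; last by exists k.
    by exists (s k); [rewrite -ki|rewrite (inj_eq perm_inj)].
  rewrite (bigD1 j)//= !mxE eq_sym (negPf sj) mul0r addr0 mul0r mulr0//.
apply: der_sum => s _; apply: derZ.
apply: der_prod => [|i _]; first exact: index_enum_uniq.
exact: dF.
Qed.

(** Jacobi's formula, by factoring A out of the pencil. *)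
Lemma der_det m (A X : 'M[R]_m) : A \in unitmx ->
  is_derive (0 : R) (1 : R) (fun t => \det (A + t *: X)) (\tr (invmx A *m X) * \det A).
Proof.
move=> uA; rewrite mulrC.
rewrite [F in is_derive _ _ F _](_ : _ =
    (fun t => \det A * \det (1%:M + t *: (invmx A *m X)))).
  by apply: derZ; exact: der_det1.
apply/funext => t; rewrite -det_mulmx mulmxDr mulmx1 -scalemxAr mulmxA.
by rewrite mulmxV// mul1mx.
Qed.

Lemma near_unit_pencil m (A X : 'M[R]_m) : A \in unitmx ->
  \forall t \near (0 : R), A + t *: X \in unitmx.
Proof.
move=> uA; have /der_continuous cd := der_det X uA.
have d0 : \det (A + 0 *: X) != 0 by rewrite scale0r addr0 -unitfE -unitmxE.
near=> t; rewrite unitmxE unitfE; near: t.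
exact: (cvgr_neq0 _ cd d0).
Unshelve. all: by end_near. Qed.

Lemma mx_der_inv m (A X : 'M[R]_m) : A \in unitmx ->
  mx_der (fun t => invmx (A + t *: X)) 0 (- (invmx A *m X *m invmx A)).
Proof.
move=> uA.
(* Cramer's rule shows that the inverse is differentiable; its derivative then
   follows from differentiating the product with A + tX, constantly 1 *)
have [G' dG] : exists G', mx_der (fun t => invmx (A + t *: X)) 0 G'.
  suff H i j : exists d, is_derive (0 : R) (1 : R) (fun t => invmx (A + t *: X) i j) d.
    have [f Hf] := choice (fun ij : 'I_m * 'I_m => H ij.1 ij.2).
    by exists (\matrix_(i, j) f (i, j)) => i j; rewrite mxE; exact: (Hf (i, j)).
  have [d dc] : exists d, is_derive (0 : R) (1 : R) (fun t => cofactor (A + t *: X) j i) d.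
    have [|d dd] := @derivable_det _ (fun t => row' j (col' i (A + t *: X))) 0 (row' j (col' i X)).
      by move=> k l; under eq_fun do rewrite !mxE; rewrite !mxE; exact: der_line.
    by exists ((-1) ^+ (j + i) * d); exact: derZ.
  have dd := der_det X uA.
  have d0 : \det (A + 0 *: X) != 0 by rewrite scale0r addr0 -unitfE -unitmxE.
  eexists; apply: der_near (derM (der_inv d0 dd) dc).
  have := near_unit_pencil X uA; apply: filterS => t ut.
  by rewrite /invmx ut !mxE.
move=> i j; have -> : - (invmx A *m X *m invmx A) = G'; last exact: dG.
have dM := mx_derM (mx_der_pencil 0 A X) dG.
have d1 : mx_der (fun t => (A + t *: X) *m invmx (A + t *: X)) 0 0.
  move=> k l; rewrite mxE; apply: der_near (der_cst 0 ((1%:M : 'M[R]_m) k l)).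
  have := near_unit_pencil X uA; apply: filterS => t ut.
  by rewrite mulmxV.
have /eqP : X *m invmx (A + 0 *: X) + (A + 0 *: X) *m G' = 0.
  by apply/matrixP => k l; apply: der_unique (dM k l) (d1 k l).
rewrite scale0r addr0 addrC addr_eq0 => /eqP E.
by rewrite -(mulKmx uA G') E mulmxN mulmxA.
Qed.

(** Each factor of the word contributes one term, where X is inserted in front of
it; cyclicity of the trace brings X to the first position. *)
Lemma der_trace_word m (A X : 'M[R]_m.+1) (w : seq 'M[R]_m.+1) : A \in unitmx ->
  is_derive (0 : R) (1 : R) (fun t => \tr (\prod_(Y <- w) (invmx (A + t *: X) *m Y)))
    (- \sum_(p < size w) \tr (\prod_(Y <- X :: rot p w) (invmx A *m Y))).
Proof.
move=> uA; pose W u (t : R) := \prod_(Y <- u) (invmx (A + t *: X) *m Y).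
pose P u := \prod_(Y <- u) (invmx A *m Y).
have A0 : A + 0 *: X = A by rewrite scale0r addr0.
have tr_cyc u v : \tr (P (u ++ v)) = \tr (P (v ++ u)).
  by rewrite /P !big_cat/=; exact: mxtrace_mulC.
have dW u : mx_der (W u) 0 (- \sum_(p < size u) P (take p u ++ X :: drop p u)).
  rewrite /W; elim: u => [|Y u IH].
    rewrite big_ord0 oppr0; under eq_fun do rewrite big_nil.
    exact: mx_der_cst.
  under eq_fun do rewrite big_cons.
  have dI : mx_der (fun t => invmx (A + t *: X) *m Y) 0 (- (invmx A *m X *m (invmx A *m Y))).
    have := mx_derM (mx_der_inv X uA) (mx_der_cst 0 Y).
    by rewrite mulmx0 addr0 mulNmx mulmxA.
  have := mx_derM dI IH; rewrite A0; congr mx_der.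
  rewrite mulmxN mulNmx -opprD; congr (- _).
  rewrite big_ord_recl mulmx_sumr; congr (_ + _).
    by rewrite /P /= !big_cons !mulmxE !mulrA.
  by apply: eq_bigr => p _; rewrite /P /= big_cons.
apply: der_val (mx_der_trace (dW w)).
rewrite (raddfN (@mxtrace R m.+1)) (raddf_sum (@mxtrace R m.+1)); congr (- _).
by apply: eq_bigr => p _; exact: tr_cyc.
Qed.

End Pencil.

(** * From a Laplace transform to moments *)
Section Cumulants.
Context {R : realType} {V : lmodType R}.
Implicit Types (D : V -> R) (k : V -> seq V -> R) (th x : V) (w : seq V).

(** [D] plays the role of a Laplace transform, and [k th w] is the part of the
joint cumulant of the letters of [w] that belongs to one cyclic order of [w]: by
[cumulants_log], - log D has derivative [k th [:: x]], and by
[cumulants_insert] each further derivative inserts a letter at all places of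
the cyclic word. *)
Record cumulants (dom : V -> Prop) D k : Prop := Cumulants {
  cumulants_gt0 : forall th, dom th -> 0 < D th;
  cumulants_cyclic : forall th u v, k th (u ++ v) = k th (v ++ u);
  cumulants_log : forall th x, dom th ->
    is_derive (0 : R) (1 : R) (fun t => D (th + t *: x)) (- (k th [:: x] * D th));
  cumulants_insert : forall th x w, dom th ->
    is_derive (0 : R) (1 : R) (fun t => k (th + t *: x) w)
      (- \sum_(p < size w) k th (x :: rot p w)) }.

Variable dom : V -> Prop.

Lemma cumulants1 : cumulants dom (fun=> 1) (fun _ _ => 0).
Proof.
split=> // [th x _|th x w _].
  by rewrite mul0r oppr0; exact: der_cst.
by rewrite big1// oppr0; exact: der_cst.
Qed.

Lemma cumulantsM D1 k1 D2 k2 : cumulants dom D1 k1 -> cumulants dom D2 k2 ->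
  cumulants dom (fun th => D1 th * D2 th) (fun th w => k1 th w + k2 th w).
Proof.
move=> [g1 c1 l1 i1] [g2 c2 l2 i2]; split=> [th dth|th u v|th x dth|th x w dth].
- by rewrite mulr_gt0 ?g1 ?g2.
- by rewrite c1 c2.
- apply: der_val (derM (l1 th x dth) (l2 th x dth)); rewrite scale0r addr0 /=.
  by ring.
- by apply: der_val (derD (i1 th x w dth) (i2 th x w dth)); rewrite big_split opprD.
Qed.

Lemma cumulants_powR D k (a : R) : cumulants dom D k ->
  cumulants dom (fun th => D th `^ a) (fun th w => a * k th w).
Proof.
move=> [g c l i]; split=> [th dth|th u v|th x dth|th x w dth].
- by rewrite powR_gt0// g.
- by rewrite c.
- have D0 : 0 < D (th + 0 *: x) by rewrite scale0r addr0 g.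
  apply: der_val (der_powR a D0 (l th x dth)); rewrite scale0r addr0.
  have dn := lt0r_neq0 (g _ dth).
  have -> : D th `^ a = D th `^ (a - 1) * D th.
    by rewrite -[X in _ * X]powRr1 ?ltW ?g// -powRD ?dn ?implybT// subrK.
  by ring.
- by apply: der_val (derZ a (i th x w dth)); rewrite mulrN mulr_sumr.
Qed.

Lemma cumulants_prod n (D : 'I_n -> V -> R) (k : 'I_n -> V -> seq V -> R) :
  (forall i, cumulants dom (D i) (k i)) ->
  cumulants dom (fun th => \prod_(i < n) D i th) (fun th w => \sum_(i < n) k i th w).
Proof.
elim: n D k => [|n IH] D k H.
  have := cumulants1; congr cumulants; apply/funext => th; first by rewrite big_ord0.
  by apply/funext => w; rewrite big_ord0.
have := cumulantsM (H ord0) (IH _ _ (fun i => H (lift ord0 i))).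
congr cumulants; apply/funext => th; first by rewrite big_ord_recl.
by apply/funext => w; rewrite big_ord_recl.
Qed.

(** The base case: a reciprocal determinant of a matrix that depends linearly on
the parameter. *)
Lemma cumulants_block m (L : V -> 'M[R]_m.+1) :
  (forall th (t : R) x, L (th + t *: x) = L th + t *: L x) ->
  (forall th, dom th -> 0 < \det (L th)) ->
  cumulants dom (fun th => (\det (L th))^-1)
    (fun th w => \tr (\prod_(x <- w) (invmx (L th) *m L x))).
Proof.
move=> linL gL; split=> [th dth|th u v|th x dth|th x w dth].
- by rewrite invr_gt0 gL.
- by rewrite !big_cat; exact: mxtrace_mulC.
- have dn := lt0r_neq0 (gL _ dth).
  under eq_fun do rewrite linL.
  have dd := @der_det R _ (L th) (L x); rewrite unitmxE unitfE dn in dd.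
  have d0 : \det (L th + 0 *: L x) != 0 by rewrite scale0r addr0.
  apply: der_val (der_inv d0 (dd isT)); rewrite scale0r addr0 big_seq1.
  by field.
- have dn := lt0r_neq0 (gL _ dth).
  under eq_fun => t do under eq_bigr do rewrite linL.
  have dw := @der_trace_word R _ (L th) (L x) (map L w).
  rewrite unitmxE unitfE dn in dw.
  have := dw isT; rewrite size_map.
  under eq_fun do rewrite big_map.
  apply: der_val; congr (- _); apply: eq_bigr => p _.
  by rewrite -map_rot -map_cons big_map.
Qed.

(** The two groups of terms of [perm_sum_recl] are those of the product rule. *)
Lemma der_perm_sum D k N (y : 'I_N.+1 -> V) th : cumulants dom D k -> dom th ->
  is_derive (0 : R) (1 : R)
    (fun t => D (th + t *: y ord0) *
       perm_sum (k (th + t *: y ord0)) (fun j => y (lift ord0 j)))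
    (- (D th * perm_sum (k th) y)).
Proof.
move=> [g c l i] dth; pose x := y ord0; pose y' j := y (lift ord0 j).
have dP : is_derive (0 : R) (1 : R) (fun t => perm_sum (k (th + t *: x)) y')
  (\sum_(s : 'S_N) \sum_(c in porbits s)
     (- \sum_(p < size [seq y' j | j <- cycle_seq s c])
        k th (x :: rot p [seq y' j | j <- cycle_seq s c])) *
     \prod_(b in porbits s | b != c)
       k (th + 0 *: x) [seq y' j | j <- cycle_seq s b]).
  apply: der_sum => s _; apply: der_prod => [|b _]; first exact: index_enum_uniq.
  exact: i.
apply: der_val (derM (l th x dth) dP); rewrite scale0r addr0.
rewrite perm_sum_recl// big_split/= -mulr_sumr -/x -/(perm_sum (k th) y').
rewrite mulrDr opprD; congr (_ + _); first by ring.
rewrite -mulrN; congr (_ * _); rewrite -sumrN; apply: eq_bigr => s _.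
by rewrite -sumrN; apply: eq_bigr => b _; rewrite size_map mulNr.
Qed.

End Cumulants.

Section Moments.
Context {R : realType} {V : lmodType R}.
Variables (dom S : V -> Prop) (D : V -> R) (k : V -> seq V -> R) (th0 : V).
Hypothesis cDk : cumulants dom D k.
Hypothesis dom_open : forall th x, dom th -> S x ->
  exists2 e : R, 0 < e & forall t, `|t| <= e -> dom (th + t *: x).
Hypothesis dom0 : dom th0.
Context d (T : measurableType d) (P : probability T R) (X : V -> T -> R).
Hypothesis mX : forall x, measurable_fun setT (X x).
Hypothesis linX : forall x (t : R) y w, X (x + t *: y) w = X x w + t * X y w.
Hypothesis laplace : forall th, dom th ->
  (\int[P]_w (expR (- X (th - th0) w))%:E = (D th / D th0)%:E)%E.

Let f N (x : 'I_N -> V) th w : R :=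
  (\prod_(j < N) X (x j) w) * expR (- X (th - th0) w).

Let mf N (x : 'I_N -> V) th : measurable_fun setT (f x th).
Proof.
apply: measurable_funM; first exact: measurable_prod.
by apply: measurableT_comp => //; exact: measurable_funN.
Qed.

Let X_line th (t : R) x w : X (th + t *: x - th0) w = X (th - th0) w + t * X x w.
Proof. by rewrite addrAC linX. Qed.

Let abs_le_expR (u : R) : `|u| <= expR u + expR (- u).
Proof.
have := expR_ge1Dx u; have := expR_ge1Dx (- u).
have := expR_ge0 u; have := expR_ge0 (- u).
by have [u0|u0] := ger0P u; lra.
Qed.

(** A factor X is absorbed by two exponentials, as |u| <= exp(u) + exp(-u) for
u = e X; the parameter stays in the open domain. *)
Lemma integrable_tilted_moment N (x : 'I_N -> V) th : (forall j, S (x j)) ->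
  dom th -> P.-integrable setT (EFin \o f x th).
Proof.
elim: N x th => [|N IH] x th Sx dth.
  apply/integrableP; split; first exact/measurable_EFinP/mf.
  rewrite (_ : (\int[P]_w _ = \int[P]_w (expR (- X (th - th0) w))%:E)%E).
    by rewrite laplace// ltry.
  apply: eq_integral => w _.
  by rewrite /= /f big_ord0 mul1r ger0_norm ?expR_ge0.
have [e e0 de] := dom_open dth (Sx ord0).
pose x' j := x (lift ord0 j).
have i1 : P.-integrable setT (EFin \o f x' (th + e *: x ord0)).
  by apply: IH => [j|]; [exact: Sx|apply: de; rewrite gtr0_norm].
have i2 : P.-integrable setT (EFin \o f x' (th + (- e) *: x ord0)).
  by apply: IH => [j|]; [exact: Sx|apply: de; rewrite normrN gtr0_norm].
have := integrableZl measurableT e^-1 (integrableD measurableT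
  (integrable_norm i1) (integrable_norm i2)).
apply: le_integrable => //; first exact/measurable_EFinP/mf.
move=> w _ /=; rewrite lee_fin.
rewrite [leRHS]ger0_norm; last by rewrite mulr_ge0 ?invr_ge0 ?(ltW e0)// addr_ge0.
rewrite /f big_ord_recl -/(x' _) !normrM !X_line.
rewrite !(ger0_norm (expR_ge0 _)) !opprD !expRD -/(x' _).
set p := `|\prod_(i < N) _|; set E := expR (- X (th - th0) w).
have -> : `|X (x ord0) w| = e^-1 * `|e * X (x ord0) w|.
  by rewrite normrM gtr0_norm// mulrA mulVf ?mul1r// lt0r_neq0.
rewrite -!mulrA ler_pM2l ?invr_gt0//.
have := abs_le_expR (e * X (x ord0) w); rewrite mulNr opprK.
set u := `|_|; set a := expR _; set b := expR _ => H.
rewrite (_ : p * (E * b) + p * (E * a) = (a + b) * (p * E)); last by ring.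
have pE : 0 <= p * E by apply: mulr_ge0; [exact: normr_ge0|exact: expR_ge0].
exact: ler_wpM2r.
Qed.

(** Each factor [X (x j)] is minus a derivative of the exponential; differentiating
the induction hypothesis in the direction of the first letter gives the
statement for one more letter. *)
Lemma tilted_moment N (x : 'I_N -> V) th : (forall j, S (x j)) -> dom th ->
  \int[P]_w f x th w = D th / D th0 * perm_sum (k th) x.
Proof.
elim: N x th => [|N IH] x th Sx dth.
  rewrite perm_sum0 mulr1 /Rintegral.
  rewrite (_ : (\int[P]_w _ = \int[P]_w (expR (- X (th - th0) w))%:E)%E).
    by rewrite laplace.
  by apply: eq_integral => w _; rewrite /f big_ord0 mul1r.
have [e e0 de] := dom_open dth (Sx ord0).
pose x' j := x (lift ord0 j).
pose F t w := f x' (th + t *: x ord0) w.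
pose g w := f x th w.
have dF t w : is_derive t (1 : R) (F ^~ w) (- (X (x ord0) w * F t w)).
  rewrite /F /f; under eq_fun do rewrite X_line.
  have dl : is_derive t (1 : R) (fun u => - (X (th - th0) w + u * X (x ord0) w))
      (- X (x ord0) w) by apply: derN; exact: der_line.
  have de' := is_derive1_comp (is_derive_expR _) dl.
  apply: der_val (derZ _ de'); rewrite X_line /=; ring.
have inI (t : R) : `]-e, e[%classic t -> `|t| <= e.
  by rewrite /= in_itv/= => /andP[a b]; rewrite ler_norml !ltW.
have I0 : `]-e, e[%classic (0 : R) by rewrite /= in_itv/= oppr_lt0 e0.
have Sx' j : S (x' j) by exact: Sx.
have iF (t : R) : `]-e, e[%classic t -> P.-integrable setT (EFin \o F t).
  by move=> /inI te; apply: integrable_tilted_moment => //; exact: de.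
have d1F t w : partial1of2 F t w = - (X (x ord0) w * F t w).
  by rewrite partial1of2E; exact: derive_val.
have F_ext t w : X (x ord0) w * F t w = f x (th + t *: x ord0) w.
  by rewrite /F /f big_ord_recl mulrA.
(* exp(- tX) lies below the sum of its values at t = e and t = -e *)
pose G w := `|f x (th + e *: x ord0) w| + `|f x (th + (- e) *: x ord0) w|.
have iG : P.-integrable setT (EFin \o G).
  have ie (t : R) : `|t| <= e -> P.-integrable setT (EFin \o f x (th + t *: x ord0)).
    by move=> te; apply: integrable_tilted_moment => //; exact: de.
  have i1 : P.-integrable setT (EFin \o f x (th + e *: x ord0)).
    by apply: ie; rewrite gtr0_norm.
  have i2 : P.-integrable setT (EFin \o f x (th + (- e) *: x ord0)).
    by apply: ie; rewrite normrN gtr0_norm.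
  exact: (integrableD measurableT (integrable_norm i1) (integrable_norm i2)).
have G_ub t w : `]-e, e[%classic t -> setT w -> `|partial1of2 F t w| <= G w.
  move=> /inI te _; rewrite d1F normrN F_ext /G /f !normrM -mulrDr.
  rewrite ler_wpM2l// !ger0_norm ?expR_ge0// !X_line !opprD !expRD -mulrDr.
  rewrite ler_wpM2l ?expR_ge0// mulNr opprK.
  have [X0|X0] := leP 0 (X (x ord0) w).
    rewrite (@le_trans _ _ (expR (e * X (x ord0) w)))// ?lerDr ?expR_ge0// ler_expR.
    by rewrite -mulNr ler_wpM2r//; move: te; rewrite ler_norml => /andP[]; lra.
  rewrite (@le_trans _ _ (expR (- (e * X (x ord0) w))))// ?lerDl ?expR_ge0// ler_expR.
  by rewrite lerN2 ler_wnM2r ?(ltW X0)//; move: te; rewrite ler_norml => /andP[].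
have derF t w : `]-e, e[%classic t -> setT w -> derivable (F ^~ w) t (1 : R).
  by move=> _ _; have [] := dF t w.
have G0 w : 0 <= G w by rewrite addr_ge0.
have dI : is_derive (0 : R) (1 : R) (fun t => \int[P]_w F t w) (- \int[P]_w f x th w).
  apply: DeriveDef.
    exact: (derivable_under_integral measurableT I0 iF derF G0 iG G_ub).
  rewrite -derive1E.
  rewrite (differentiation_under_integral measurableT I0 iF derF G0 iG G_ub).
  rewrite -[RHS]mulN1r -RintegralZl//; last exact: integrable_tilted_moment.
  by apply: eq_Rintegral => w _; rewrite d1F F_ext scale0r addr0 mulN1r.
have dD : is_derive (0 : R) (1 : R) (fun t => \int[P]_w F t w)
    ((D th0)^-1 * - (D th * perm_sum (k th) x)).
  apply: der_near (derZ (D th0)^-1 (der_perm_sum x cDk dth)).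
  have : \forall t \near (0 : R), `|t| <= e by exact: nbhs0_le.
  by apply: filterS => t te; rewrite /F IH//; [rewrite mulrA [_^-1 * _]mulrC|exact: de].
have := der_unique dI dD; rewrite mulrN => /oppr_inj ->.
by rewrite mulrA; congr (_ * _); rewrite mulrC.
Qed.

Lemma moment_perm_sum N (x : 'I_N -> V) : (forall j, S (x j)) ->
  (\int[P]_w (\prod_(j < N) X (x j) w)%:E = (perm_sum (k th0) x)%:E)%E.
Proof.
move=> Sx; have X0 w : X 0 w = 0.
  have := linX 0 1 0 w; rewrite scale1r addr0 mul1r => E.
  by apply: (addrI (X 0 w)); rewrite -E addr0.
have fE : f x th0 = fun w => \prod_(j < N) X (x j) w.
  by apply/funext => w; rewrite /f subrr X0 oppr0 expR0 mulr1.
have := tilted_moment Sx dom0; have := integrable_tilted_moment Sx dom0.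
rewrite fE divff ?mul1r ?lt0r_neq0 ?(cumulants_gt0 cDk)// => iX <-.
by rewrite /Rintegral fineK//; exact: integrable_fin_num.
Qed.

End Moments.

(** * Continuants *)

(** Diagonals are infinite streams, of which a statement about a path with k
vertices reads an initial segment; removing vertices is then a shift, without
casts between sizes. *)
Section Streams.
Variable R : Type.
Definition scons (y : R) (f : nat -> R) i := if i is j.+1 then f j else y.
Definition tail (f : nat -> R) i := f i.+1.
Definition skip (i : nat) (f : nat -> R) j := f (i + j)%N.
End Streams.

Section Continuant.
Variable R : realType.
Implicit Types (a b s ta tb : nat -> R).

(** The continuant: the determinant of the symmetric tridiagonal matrix with
diagonal a and off-diagonal b, expanded along its first row. *)
Fixpoint tridet (k : nat) a b : R :=
  match k with
  | 0 => 1
  | j.+1 => match j with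
            | 0 => a 0%N
            | i.+1 => a 0%N * tridet j (tail a) (tail b)
                      - b 0%N ^+ 2 * tridet i (tail (tail a)) (tail (tail b))
            end
  end.

Arguments tridet : simpl never.

Lemma tridet0 a b : tridet 0 a b = 1. Proof. by []. Qed.

Lemma tridet1 a b : tridet 1 a b = a 0%N. Proof. by []. Qed.

Lemma tridetSS k a b : tridet k.+2 a b = a 0%N * tridet k.+1 (tail a) (tail b)
  - b 0%N ^+ 2 * tridet k (tail (tail a)) (tail (tail b)).
Proof. by []. Qed.

(** The diagonal after elimination of the first vertex; the off-diagonal is merely
shifted. *)
Definition schur a b : nat -> R :=
  scons (a 1%N - b 0%N ^+ 2 / a 0%N) (tail (tail a)).

Lemma tridet_schur k a b : a 0%N != 0 ->
  tridet k.+1 a b = a 0%N * tridet k (schur a b) (tail b).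
Proof.
move=> a0; case: k => [|[|k]]; first by rewrite /= mulr1.
  by rewrite tridetSS !tridet1 tridet0 /schur /= /tail; field.
rewrite !tridetSS (_ : tail (schur a b) = tail (tail a))//.
rewrite (_ : schur a b 0%N = a 1%N - b 0%N ^+ 2 / a 0%N)//.
by rewrite /(tail a 0%N); field.
Qed.

(** Positive definiteness, as positivity of the pivots of Gaussian elimination. *)
Fixpoint band_pos (k : nat) a b : bool :=
  if k is j.+1 then (0 < a 0%N) && band_pos j (schur a b) (tail b) else true.

Lemma band_pos_tridet k a b : band_pos k a b -> 0 < tridet k a b.
Proof.
elim: k a b => [//|k IH] a b; rewrite [band_pos _ _ _]/= => /andP[a0 /IH].
by rewrite tridet_schur ?gt_eqF//; exact: mulr_gt0.
Qed.

Lemma band_pos_le k j a b : (j <= k)%N -> band_pos k a b -> band_pos j a b.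
Proof.
elim: k j a b => [|k IH] [|j] a b //= jk /andP[-> /=]; exact: IH.
Qed.

(** Sylvester's criterion can also be run from the last vertex.  The proof plays
off the two expressions of the continuant: its expansion and its Schur
form. *)
Lemma band_pos_suffix k a b : band_pos k.+1 a b =
  band_pos k (tail a) (tail b) && (0 < tridet k.+1 a b).
Proof.
elim: k a b => [|k IH] a b; first by rewrite /= andbT.
rewrite [LHS]/= -/(band_pos k.+1 _ _) !IH.
rewrite (_ : tail (schur a b) = tail (tail a))//.
case: (boolP (band_pos k _ _)) => [/band_pos_tridet D0|]; last by rewrite andbF.
rewrite /=; set D1 := tridet k.+1 (tail a) (tail b).
set D2 := tridet k.+2 a b; set D3 := tridet k.+1 (schur a b) (tail b).
have D2E : D2 = a 0%N * D1 - b 0%N ^+ 2 * tridet k (tail (tail a)) (tail (tail b)) by [].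
have bD : 0 <= b 0%N ^+ 2 * tridet k (tail (tail a)) (tail (tail b)).
  by rewrite mulr_ge0// ?sqr_ge0// ltW.
have [a0|a0] := ltP 0 (a 0%N).
  have D2E' : D2 = a 0%N * D3 by exact/tridet_schur/lt0r_neq0.
  rewrite /= D2E' pmulr_rgt0//; have [D3p|] := ltP 0 D3; last by rewrite andbF.
  rewrite andbT; apply/esym; rewrite -(pmulr_rgt0 D1 a0).
  have -> : a 0%N * D1 = D2 + b 0%N ^+ 2 * tridet k (tail (tail a)) (tail (tail b)).
    by rewrite D2E subrK.
  by rewrite ltr_wpDr// D2E' mulr_gt0.
apply/esym/negP => /andP[D1p]; rewrite D2E subr_gt0 => /(le_lt_trans bD).
by rewrite pmulr_lgt0// ltNge a0.
Qed.

(** The pairing, the power function and the Wishart density in the coordinates of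
a path with vertices 0..m and root c. *)
Definition band_pairing (m : nat) ta tb a b : R :=
  \sum_(i < m.+1) ta i * a i + 2 * \sum_(i < m) tb i * b i.

Definition band_Delta (c m : nat) s a b : R :=
  (\prod_(i < c) tridet i.+1 a b `^ (s i - s i.+1))
  * tridet m.+1 a b `^ s c
  * \prod_(i < m - c) tridet (m - c - i) (skip (c.+1 + i) a) (skip (c.+1 + i) b)
       `^ (s (c + i).+1 - s (c + i)%N).

Definition band_weight (c m : nat) s ta tb a b : R :=
  if band_pos m.+1 a b then expR (- band_pairing m ta tb a b) * band_Delta c m s a b
  else 0.

Definition gamma_weight (s t z : R) : R :=
  if 0 < z then z `^ s * expR (- (t * z)) else 0.

Lemma gamma_weight_ge0 (s t z : R) : 0 <= gamma_weight s t z.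
Proof.
by rewrite /gamma_weight; case: ifP => // _; rewrite mulr_ge0 ?powR_ge0 ?expR_ge0.
Qed.

Lemma band_pairing_recl m ta tb a b : band_pairing m.+1 ta tb a b =
  ta 0%N * a 0%N + 2 * (tb 0%N * b 0%N) +
  band_pairing m (tail ta) (tail tb) (tail a) (tail b).
Proof.
rewrite /band_pairing big_ord_recl.
by rewrite (big_ord_recl m (fun i : 'I_m.+1 => tb i * b i)) mulrDr addrACA.
Qed.

Lemma band_pairing_head m ta tb a b d :
  band_pairing m ta tb (scons (a 0%N - d) (tail a)) b =
  band_pairing m ta tb a b - ta 0%N * d.
Proof.
rewrite /band_pairing big_ord_recl [in RHS]big_ord_recl/= mulrBr.
by rewrite -!addrA; congr (_ + _); rewrite addrC -!addrA.
Qed.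

(** The powers of the eliminated pivot, collected over all the minors. *)
Lemma powR_telescope c s (y : R) : 0 < y ->
  (\prod_(i < c) y `^ (s i - s i.+1)) * y `^ s c = y `^ s 0%N.
Proof.
move=> y0; have yn := lt0r_neq0 y0.
elim: c => [|c IH]; first by rewrite big_ord0 mul1r.
rewrite big_ord_recr/= -mulrA -powRD; last by rewrite yn implybT.
by rewrite subrK.
Qed.

(** Elimination of a first vertex that is not the root. *)
Lemma band_weight_peel c m s ta tb y a z b : (c <= m)%N ->
  band_weight c.+1 m.+1 s ta tb (scons y a) (scons z b) =
  gamma_weight (s 0%N) (ta 0%N) y * expR (- (ta 1%N * (z ^+ 2 / y) + 2 * (tb 0%N * z)))
  * band_weight c m (tail s) (tail ta) (tail tb)
      (scons (a 0%N - z ^+ 2 / y) (tail a)) b.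
Proof.
move=> cm; rewrite /band_weight /gamma_weight [band_pos _ _ _]/=.
have [y0|] := ltP 0 y; last by rewrite !mul0r.
rewrite [_ && _]/= -/(band_pos m.+1 _ _).
rewrite (_ : schur _ _ = scons (a 0%N - z ^+ 2 / y) (tail a))//.
set a' := scons (a 0%N - _) _; rewrite (_ : tail (scons z b) = b)//.
case: ifPn => [pos|_]; last by rewrite mulr0.
have dE j : tridet j.+1 (scons y a) (scons z b) = y * tridet j a' b.
  by rewrite tridet_schur//= gt_eqF.
have d0 j : (j <= m.+1)%N -> 0 <= tridet j a' b.
  by move=> jm; apply/ltW/band_pos_tridet/band_pos_le/pos.
rewrite [RHS](_ : _ = (expR (- (ta 0%N * y)) *
    expR (- (ta 1%N * (z ^+ 2 / y) + 2 * (tb 0%N * z))) *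
    expR (- band_pairing m (tail ta) (tail tb) a' b)) *
   (y `^ s 0%N * band_Delta c m (tail s) a' b)); last by ring.
congr (_ * _).
- rewrite -!expRD; congr expR; rewrite band_pairing_recl band_pairing_head /=.
  by rewrite /(tail ta 0%N); ring.
rewrite /band_Delta subSS -(powR_telescope c.+1 s y0).
rewrite (eq_bigr (fun i : 'I_c.+1 => y `^ (s i - s i.+1) *
    tridet i a' b `^ (s i - s i.+1))) => [|i _]; last first.
  by rewrite dE powRM ?(ltW y0)// d0// (leq_trans _ (leqW cm))// -ltnS.
rewrite big_split/= [X in _ * X * _ * _ = _]big_ord_recl tridet0 powR1 mul1r.
rewrite dE powRM ?(ltW y0) ?d0//.
rewrite mulrACA !mulrA; congr (_ * _ * _ * _); exact: eq_bigr.
Qed.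

(** The first pivot when the path is eliminated from its last vertex. *)
Definition det_ratio m a b := tridet m.+1 a b / tridet m (tail a) (tail b).

(** The density rooted at the first vertex, in terms of the pivots.  The weight [h]
of the first pivot is a parameter because integrating it out replaces the gamma
weight of the next pivot by another one. *)
Fixpoint ratio_weight (h : R -> R) m s ta tb a b : R :=
  if m is k.+1 then
    h (det_ratio m a b) *
    expR (- (ta 0%N * (b 0%N ^+ 2 / det_ratio k (tail a) (tail b)) +
             2 * (tb 0%N * b 0%N))) *
    ratio_weight (gamma_weight (s 1%N) (ta 1%N)) k
      (tail s) (tail ta) (tail tb) (tail a) (tail b)
  else h (a 0%N).

Lemma det_ratio_rec m a b : tridet m.+1 (tail a) (tail b) != 0 ->
  det_ratio m.+1 a b = a 0%N - b 0%N ^+ 2 / det_ratio m (tail a) (tail b).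
Proof.
move=> D0; rewrite /det_ratio tridetSS mulrBl mulfK//; congr (_ - _).
by rewrite invfM invrK mulrA mulrAC.
Qed.

(** A power of the minor on {i..n} and one of the minor on {i+1..n} combine into a
power of their quotient; positivity of all the quotients is positive
definiteness, by [band_pos_suffix]. *)
Lemma band_weight_root0 m s ta tb a b : band_weight 0 m s ta tb a b =
  ratio_weight (gamma_weight (s 0%N) (ta 0%N)) m s ta tb a b.
Proof.
elim: m s ta tb a b => [|m IH] s ta tb a b.
  rewrite /band_weight /gamma_weight/= andbT; case: ifP => // a0.
  rewrite /band_pairing /band_Delta !big_ord0 big_ord1 tridet1 mulr0 addr0 mul1r mulr1.
  by rewrite mulrC.
rewrite [RHS]/= -IH {IH}/band_weight band_pos_suffix.
have [pos|_] := ifPn (band_pos m.+1 (tail a) (tail b)); last first.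
  by rewrite mulr0.
have D1 := band_pos_tridet pos.
have D0 : 0 < tridet m (tail (tail a)) (tail (tail b)).
  by apply: band_pos_tridet; move: pos; rewrite band_pos_suffix => /andP[].
have qE := @det_ratio_rec m a b (lt0r_neq0 D1).
rewrite [true && _]/= /gamma_weight.
have -> : (0 < det_ratio m.+1 a b) = (0 < tridet m.+2 a b).
  by rewrite /det_ratio pmulr_lgt0// invr_gt0.
have [D2|] := ltP 0 (tridet m.+2 a b); last by rewrite !mul0r.
set q := det_ratio m.+1 a b in qE *; set q' := det_ratio m _ _ in qE *.
have q0 : 0 < q by rewrite divr_gt0.
rewrite [RHS](_ : _ = (expR (- (ta 0%N * q)) *
    expR (- (ta 0%N * (b 0%N ^+ 2 / q') + 2 * (tb 0%N * b 0%N))) *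
    expR (- band_pairing m (tail ta) (tail tb) (tail a) (tail b))) *
   (q `^ s 0%N * band_Delta 0 m (tail s) (tail a) (tail b))); last by ring.
congr (_ * _).
  by rewrite -!expRD band_pairing_recl; congr expR; rewrite qE; ring.
rewrite /band_Delta !big_ord0 !mul1r !subn0 big_ord_recl.
rewrite (_ : tridet _ (skip _ a) (skip _ b) = tridet m.+1 (tail a) (tail b))//.
rewrite !mulrA; congr (_ * _).
rewrite /(tail s 0%N) /q powRM ?ltW// ?invr_gt0//.
rewrite -mulrA -powR_inv1; last exact: ltW.
rewrite -powRrM mulN1r -powRD; last by rewrite lt0r_neq0 ?implybT.
by rewrite addrC.
Qed.

Lemma ratio_weight_ge0 h m s ta tb a b : (forall z, 0 <= h z) ->
  0 <= ratio_weight h m s ta tb a b.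
Proof.
elim: m h s ta tb a b => [|m IH] h s ta tb a b h0 //=.
by rewrite !mulr_ge0 ?expR_ge0// IH//; exact: gamma_weight_ge0.
Qed.

End Continuant.

Arguments tridet {R} k a b : simpl never.

(** * Gaussian and gamma integrals *)
Section Line.
Context {R : realType}.
Local Notation leb := (@lebesgue_measure R).
Local Open Scope ereal_scope.

(** Both sides are integrals for measures that agree on half-open intervals. *)
Lemma ge0_integral_affine (a c : R) (f : measurableTypeR R -> \bar R) : (0 < a)%R ->
  measurable_fun setT f -> (forall x, 0 <= f x) ->
  \int[leb]_x f (a * x + c)%R = a^-1%:E * \int[leb]_x f x.
Proof.
move=> a0 mf f0; pose phi (x : measurableTypeR R) : measurableTypeR R := (a * x + c)%R.
have mphi : measurable_fun setT phi.
  by apply: measurable_funD => //; exact: measurable_funM.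
have E : \int[leb]_x f x = a%:E * \int[leb]_x f (phi x).
  rewrite -[RHS](_ : \int[mscale (NngNum (ltW a0)) (pushforward leb phi)]_x f x = _); last first.
    rewrite ge0_integral_mscale// ge0_integral_pushforward//.
  apply: eq_measure_integral => A mA _; apply: lebesgue_measure_unique => //.
  move=> _ [[x y]] _ <-; rewrite /= /mscale/= /pushforward.
  rewrite (_ : phi @^-1` _ = `]((x - c) / a)%R, ((y - c) / a)%R]%classic); last first.
    apply/seteqP; split => z /=; rewrite !in_itv/= /phi.
      by rewrite ltr_pdivrMr// ler_pdivlMr// ltrBlDr lerBrDr ![(z * a)%R]mulrC.
    by rewrite ltr_pdivrMr// ler_pdivlMr// ltrBlDr lerBrDr ![(z * a)%R]mulrC.
  rewrite !lebesgue_measure_itv/= !lte_fin ltr_pM2r ?invr_gt0// ltrD2r.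
  case: ifP => _; last by rewrite mule0.
  by rewrite -!EFinD -EFinM; congr EFin; field; exact: lt0r_neq0.
by rewrite E muleA -EFinM mulVf ?mul1e// lt0r_neq0.
Qed.

Lemma ge0_integral_scale d (T : measurableType d) (mu : {measure set T -> \bar R})
    (k : R) (f : T -> R) : measurable_fun setT f ->
  (forall x, 0 <= f x)%R -> (0 <= k)%R ->
  \int[mu]_x (k * f x)%:E = k%:E * \int[mu]_x (f x)%:E.
Proof.
move=> mf f0 k0; under eq_integral do rewrite EFinM.
apply: ge0_integralZl_EFin => //; last exact/measurable_EFinP.
by move=> x _; rewrite lee_fin.
Qed.

(** The masses are kept as unevaluated extended reals: they enter the Laplace
transform only as factors that cancel. *)
Definition gauss_mass : \bar R := \int[leb]_x (expR (- x ^+ 2))%:E.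

(** Completion of the square. *)
Lemma integral_gauss (al be : R) : (0 < al)%R ->
  \int[leb]_x (expR (- (al * x ^+ 2 + 2 * (be * x))))%:E =
  (al `^ (- 2^-1) * expR (be ^+ 2 / al))%:E * gauss_mass.
Proof.
move=> al0; set r := Num.sqrt al.
have r0 : (0 < r)%R by rewrite sqrtr_gt0.
have r2 : (r ^+ 2 = al)%R by rewrite sqr_sqrtr// ltW.
have mg : measurable_fun setT (fun x : measurableTypeR R => expR (- x ^+ 2)).
  apply: measurableT_comp => //.
  by apply: measurable_funN; exact: measurable_funX.
transitivity (\int[leb]_x (expR (be ^+ 2 / al) *
    expR (- (r * x + be / r) ^+ 2))%:E).
  apply: eq_integral => x _; rewrite -expRD; congr (expR _)%:E.
  by rewrite -r2; field; exact: lt0r_neq0.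
rewrite ge0_integral_scale ?expR_ge0//; last first.
  apply: measurableT_comp => //; apply: measurable_funN.
  by apply: measurable_funX; exact: measurable_funD.
rewrite (@ge0_integral_affine _ _ (fun x => (expR (- x ^+ 2))%:E) r0); first last.
- by move=> x; rewrite lee_fin expR_ge0.
- exact/measurable_EFinP.
rewrite muleA -EFinM; congr (_%:E * _); rewrite mulrC; congr (_ * _)%R.
by rewrite powRN powR12_sqrt// ltW.
Qed.

Lemma measurable_gamma_weight (s t : R) :
  measurable_fun setT (gamma_weight s t : measurableTypeR R -> R).
Proof.
rewrite /gamma_weight; apply: measurable_fun_ifT => //.
- exact: measurable_fun_ltr.
- apply: measurable_funM; first exact: measurable_powR.
  apply: measurableT_comp => //; apply: measurable_funN.
  exact: measurable_funM.
Qed.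

Definition gamma_mass (s : R) : \bar R := \int[leb]_z (gamma_weight s 1 z)%:E.

Lemma integral_gamma (s t : R) : (0 < t)%R ->
  \int[leb]_z (gamma_weight s t z)%:E = (t `^ (- (s + 1)))%:E * gamma_mass s.
Proof.
move=> t0.
transitivity (\int[leb]_x (t `^ (- s) * gamma_weight s 1 (t * x + 0))%:E).
  apply: eq_integral => z _; congr EFin.
  rewrite /gamma_weight addr0 pmulr_rgt0// mul1r.
  case: ifPn => z0; last by rewrite mulr0.
  rewrite powRM ?ltW// !mulrA -powRD; last by rewrite lt0r_neq0 ?implybT.
  by rewrite addNr powRr0 mul1r.
rewrite ge0_integral_scale ?powR_ge0//; first last.
- by move=> x; exact: gamma_weight_ge0.
- apply: (@measurableT_comp _ _ _ _ _ _ _ _ (fun x : measurableTypeR R =>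
    t * x + 0)%R (measurable_gamma_weight s 1)).
  exact: measurable_funD.
rewrite (@ge0_integral_affine _ _ (fun x => (gamma_weight s 1 x)%:E) t0); first last.
- by move=> x; rewrite lee_fin gamma_weight_ge0.
- by apply/measurable_EFinP; exact: measurable_gamma_weight.
rewrite muleA -EFinM; congr (_%:E * _).
rewrite -powR_inv1 ?ltW// -powRD; last by rewrite lt0r_neq0 ?implybT.
by rewrite opprD.
Qed.

End Line.

(** * Integration over the coordinates of the band *)
Section Tuples.
Context {R : realType}.
Local Notation Rm := (measurableTypeR R).
Local Notation leb := (@lebesgue_measure R).

Lemma measurable_tuple_nth m i :
  measurable_fun setT (fun t : m.-tuple Rm => nth 0 t i : Rm).
Proof.
have [im|mi] := ltnP i m; last first.
  rewrite (_ : (fun _ => _) = cst 0)//.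
  by apply/funext => t; rewrite nth_default// size_tuple.
under eq_fun do rewrite -(tnth_nth 0 _ (Ordinal im)).
exact: measurable_tnth.
Qed.

Lemma measurable_nth_comp d (X : measurableType d) m (f : X -> m.-tuple Rm) i :
  measurable_fun setT f -> measurable_fun setT (fun x => nth 0 (f x) i : Rm).
Proof.
by move=> mf; exact: (measurableT_comp (@measurable_tuple_nth m i) mf).
Qed.

Section Head.
Context d (X : measurableType d) (mu : {sigma_finite_measure set X -> \bar R}).
Variable m : nat.
Local Open Scope ereal_scope.

Lemma ge0_integral_tuple_head (f : m.+1.-tuple Rm * X -> \bar R) :
  measurable_fun setT f -> (forall p, 0 <= f p) ->
  \int[lebesgue_tuple m.+1 \x mu]_p f p =
  \int[leb]_y \int[lebesgue_tuple m \x mu]_p f ([tuple of y :: p.1], p.2).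
Proof.
move=> mf f0; rewrite fubini_tonelli1//.
have mF := measurable_fun_fubini_tonelli_F (m2 := mu) f mf f0.
pose c (p : Rm * m.-tuple Rm) : m.+1.-tuple Rm := [tuple of p.1 :: p.2].
have mc : measurable_fun setT c by exact: measurable_cons.
have F0 t : 0 <= fubini_F mu f t by exact: integral_ge0.
rewrite (_ : \int[_]_x _ = \int[leb \x lebesgue_tuple m]_p (fubini_F mu f \o c) p).
  rewrite fubini_tonelli1//; first last.
  - by move=> p; exact: F0.
  - exact: (measurableT_comp mF mc).
  apply: eq_integral => y _; rewrite fubini_tonelli1//.
  apply: (measurableT_comp mf); apply: measurable_fun_pair => //.
  exact: (measurable_cons (f := cst y)).
by rewrite /= ge0_integral_pushforward.
Qed.

Lemma ge0_integral_tuple_head2 (f : X * m.+1.-tuple Rm -> \bar R) :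
  measurable_fun setT f -> (forall p, 0 <= f p) ->
  \int[mu \x lebesgue_tuple m.+1]_p f p =
  \int[leb]_y \int[mu \x lebesgue_tuple m]_p f (p.1, [tuple of y :: p.2]).
Proof.
move=> mf f0; rewrite fubini_tonelli2//.
have mF := measurable_fun_fubini_tonelli_G (m1 := mu) f mf f0.
pose c (p : Rm * m.-tuple Rm) : m.+1.-tuple Rm := [tuple of p.1 :: p.2].
have mc : measurable_fun setT c by exact: measurable_cons.
have F0 t : 0 <= fubini_G mu f t by exact: integral_ge0.
rewrite (_ : \int[_]_x _ = \int[leb \x lebesgue_tuple m]_p (fubini_G mu f \o c) p).
  rewrite fubini_tonelli1//; first last.
  - by move=> p; exact: F0.
  - exact: (measurableT_comp mF mc).
  apply: eq_integral => y _; rewrite fubini_tonelli2//.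
  apply: (measurableT_comp mf); apply: measurable_fun_pair => //.
  exact: (measurable_cons (f := cst y)).
by rewrite /= ge0_integral_pushforward.
Qed.
End Head.

Section Swap.
Local Open Scope ereal_scope.

(** Two scalar variables are moved inside, one after the other. *)
Lemma ge0_integral_swap2 d (X : measurableType d)
    (mu : {sigma_finite_measure set X -> \bar R}) (G : Rm -> Rm -> X -> \bar R) :
  measurable_fun setT (fun q : (Rm * Rm) * X => G q.1.1 q.1.2 q.2) ->
  (forall z y p, 0 <= G z y p) ->
  \int[leb]_z \int[leb]_y \int[mu]_p G z y p =
  \int[mu]_p \int[leb]_z \int[leb]_y G z y p.
Proof.
move=> mG G0.
have mc (z : Rm) : measurable_fun setT (fun q : Rm * X => ((z, q.1), q.2)).
  apply: measurable_fun_pair => /=; last exact: measurable_snd.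
  apply: measurable_fun_pair; [exact: measurable_cst|exact: measurable_fst].
transitivity (\int[leb]_z \int[mu]_p \int[leb]_y G z y p).
  apply: eq_integral => z _.
  apply: (fubini_tonelli (fun q => G z q.1 q.2)) => //.
  exact: (measurableT_comp mG (mc z)).
apply: (fubini_tonelli (fun q => \int[leb]_y G q.1 y q.2)) => [|q]; last first.
  exact: integral_ge0.
apply: (measurable_fun_fubini_tonelli_F (m2 := leb)
  (fun q : (Rm * X) * Rm => G q.1.1 q.2 q.1.2)) => //.
have mp : measurable_fun setT (fun q : (Rm * X) * Rm => ((q.1.1, q.2), q.1.2)).
  apply: measurable_fun_pair; last exact: (measurableT_comp measurable_snd measurable_fst).
  apply: measurable_fun_pair; last exact: measurable_snd.
  exact: (measurableT_comp measurable_fst measurable_fst).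
exact: (measurableT_comp mG mp).
Qed.

Context d1 d2 (X1 : measurableType d1) (X2 : measurableType d2)
  (mu1 : {sigma_finite_measure set X1 -> \bar R})
  (mu2 : {sigma_finite_measure set X2 -> \bar R}).

(** The product of the measures on the two diagonals has to be a factor in further
applications of Fubini's theorem. *)
Lemma sigma_finite_product : sigma_finite setT (mu1 \x mu2).
Proof.
have /sigma_finiteP[F [TF ndF Foo]] := sigma_finiteT mu1.
have /sigma_finiteP[G [TG ndG Goo]] := sigma_finiteT mu2.
exists (fun k => F k `*` G k).
  rewrite -setXTT TF TG predeqE => -[x y]; split.
    move=> [/= [k _ Fkx] [l _ Gly]]; exists (maxn k l) => //; split.
    - by move: x Fkx; exact/subsetPset/ndF/leq_maxl.
    - by move: y Gly; exact/subsetPset/ndG/leq_maxr.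
  by move=> [k _ []/= ? ?]; split; exists k.
move=> k; have [? ?] := Foo k; have [? ?] := Goo k.
split; first exact: measurableX.
by rewrite product_measure1E// lte_mul_pinfty// ge0_fin_numE.
Qed.

Let prod_mixin := Measure_isSigmaFinite.Build _ _ _ (mu1 \x mu2) sigma_finite_product.
Let prod_pack : {sigma_finite_measure set (X1 * X2)%type -> \bar R} :=
  HB.pack (mu1 \x mu2) prod_mixin.

Lemma ge0_integral_swap2_prod (G : Rm -> Rm -> X1 * X2 -> \bar R) :
  measurable_fun setT (fun q : (Rm * Rm) * (X1 * X2) => G q.1.1 q.1.2 q.2) ->
  (forall z y p, 0 <= G z y p) ->
  \int[leb]_z \int[leb]_y \int[mu1 \x mu2]_p G z y p =
  \int[mu1 \x mu2]_p \int[leb]_z \int[leb]_y G z y p.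
Proof. exact: (@ge0_integral_swap2 _ _ prod_pack). Qed.

Lemma measurable_integral_prod (G : Rm -> X1 * X2 -> \bar R) :
  measurable_fun setT (fun q : Rm * (X1 * X2) => G q.1 q.2) ->
  (forall y p, 0 <= G y p) ->
  measurable_fun setT (fun y => \int[mu1 \x mu2]_p G y p).
Proof.
move=> mG G0; exact: (@measurable_fun_fubini_tonelli_F _ _ _ _ _ prod_pack _ mG).
Qed.

End Swap.

(** Measurability is asked for all streams that depend measurably on a parameter:
this form is stable under shifts and insertions, whatever the length of the
tuples that are read. *)
Definition stream_measurable (g : (nat -> R) -> (nat -> R) -> R) :=
  forall d (X : measurableType d) (a b : nat -> X -> R),
    (forall i, measurable_fun setT (a i)) ->
    (forall i, measurable_fun setT (b i)) ->
    measurable_fun setT (fun x => g (a ^~ x) (b ^~ x)).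

(** The tuples of coordinates are read as streams that vanish beyond their end. *)
Definition band_integral m (g : (nat -> R) -> (nat -> R) -> R) : \bar R :=
  (\int[lebesgue_tuple m.+1 \x lebesgue_tuple m]_p (g (nth 0 p.1) (nth 0 p.2))%:E)%E.

Lemma nth_scons (y : R) (t : seq R) : nth 0 (y :: t) = scons y (nth 0 t).
Proof. by apply/funext => -[]. Qed.

Lemma scons_family d (X : measurableType d) (f : X -> R) (a : nat -> X -> R) :
  measurable_fun setT f -> (forall i, measurable_fun setT (a i)) ->
  forall i, measurable_fun setT (fun x => scons (f x) (a ^~ x) i).
Proof. by move=> mf ma [|i]; [exact: mf|exact: ma]. Qed.

Section Peel.
Variables (m : nat) (g : (nat -> R) -> (nat -> R) -> R).
Hypotheses (mg : stream_measurable g) (g0 : forall a b, 0 <= g a b).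
Local Open Scope ereal_scope.

Let ma k l i : measurable_fun setT
  (fun p : k.-tuple Rm * l.-tuple Rm => nth 0%R p.1 i : Rm).
Proof. exact: (measurable_nth_comp _ measurable_fst). Qed.

Let mb k l i : measurable_fun setT
  (fun p : k.-tuple Rm * l.-tuple Rm => nth 0%R p.2 i : Rm).
Proof. exact: (measurable_nth_comp _ measurable_snd). Qed.

Let mgT k l : measurable_fun setT
  (fun p : k.-tuple Rm * l.-tuple Rm => (g (nth 0%R p.1) (nth 0%R p.2))%:E).
Proof.
apply/measurable_EFinP; exact: (mg (@ma _ _) (@mb _ _)).
Qed.

Let gE0 a b : 0 <= (g a b)%:E. Proof. by rewrite lee_fin. Qed.

Lemma band_integral_head :
  band_integral m g = \int[leb]_y
    \int[lebesgue_tuple m \x lebesgue_tuple m]_p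
      (g (scons y (nth 0%R p.1)) (nth 0%R p.2))%:E.
Proof.
rewrite /band_integral (@ge0_integral_tuple_head _ _ _ _ _ (@mgT _ _)); last by move=> p; exact: gE0.
by under eq_integral do under eq_integral do rewrite /= nth_scons.
Qed.

(** The first vertex and the first edge become the outer variables. *)
Lemma band_integral_peel :
  band_integral m.+1 g = \int[leb]_y \int[leb]_z
    band_integral m (fun a b => g (scons y a) (scons z b)).
Proof.
rewrite /band_integral (@ge0_integral_tuple_head _ _ _ _ _ (@mgT _ _)); last by move=> p; exact: gE0.
apply: eq_integral => y _; rewrite ge0_integral_tuple_head2/=; last first.
- by move=> p; exact: gE0.
- rewrite [X in measurable_fun _ X](_ : _ = (fun p : m.+1.-tuple Rm * m.+1.-tuple Rm =>
    (g (scons y (nth 0%R p.1)) (nth 0%R p.2))%:E)); last first.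
    by apply/funext => p; rewrite /= nth_scons.
  apply/measurable_EFinP.
  exact: (mg (scons_family (measurable_cst y) (@ma _ _)) (@mb _ _)).
by under eq_integral do under eq_integral do rewrite !nth_scons.
Qed.

(** The same splitting with the first vertex and the first edge as inner
variables, so that they can be integrated for fixed values of the others. *)
Lemma band_integral_peel_inner :
  band_integral m.+1 g =
  \int[lebesgue_tuple m.+1 \x lebesgue_tuple m]_p \int[leb]_z \int[leb]_y
    (g (scons y (nth 0%R p.1)) (scons z (nth 0%R p.2)))%:E.
Proof.
rewrite /band_integral (@ge0_integral_tuple_head2 _ _ _ _ _ (@mgT _ _)); last by move=> p; exact: gE0.
rewrite -(@ge0_integral_swap2_prod _ _ _ _ (lebesgue_tuple m.+1) (lebesgue_tuple m)
  (fun z y p => (g (scons y (nth 0%R p.1)) (scons z (nth 0%R p.2)))%:E)); first last.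
- by move=> *; exact: gE0.
- apply/measurable_EFinP.
  have m11 := measurableT_comp measurable_fst (@measurable_fst _ _ (Rm * Rm)%type (m.+1.-tuple Rm * m.-tuple Rm)%type).
  have m12 := measurableT_comp measurable_snd (@measurable_fst _ _ (Rm * Rm)%type (m.+1.-tuple Rm * m.-tuple Rm)%type).
  have m21 := measurableT_comp measurable_fst (@measurable_snd _ _ (Rm * Rm)%type (m.+1.-tuple Rm * m.-tuple Rm)%type).
  have m22 := measurableT_comp measurable_snd (@measurable_snd _ _ (Rm * Rm)%type (m.+1.-tuple Rm * m.-tuple Rm)%type).
  exact: (mg (scons_family m12 (fun i => measurable_nth_comp i m21))
             (scons_family m11 (fun i => measurable_nth_comp i m22))).
apply: eq_integral => z _.
rewrite ge0_integral_tuple_head; first last.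
- by move=> p; exact: gE0.
- rewrite [X in measurable_fun _ X](_ : _ = (fun p : m.+2.-tuple Rm * m.-tuple Rm =>
    (g (nth 0%R p.1) (scons z (nth 0%R p.2)))%:E)); last first.
    by apply/funext => p; rewrite /= nth_scons.
  apply/measurable_EFinP.
  exact: (mg (@ma _ _) (scons_family (measurable_cst z) (@mb _ _))).
by under eq_integral do under eq_integral do rewrite !nth_scons.
Qed.

End Peel.

Lemma band_integral_shift m g (e : R) : stream_measurable g ->
  (forall a b, 0 <= g a b) ->
  band_integral m (fun a b => g (scons (a 0%N - e) (tail a)) b) = band_integral m g.
Proof.
move=> mg g0; have mg' : stream_measurable (fun a b => g (scons (a 0%N - e) (tail a)) b).
  move=> d X a b ma mb.
  apply: (mg _ _ _ _ (scons_family (measurable_funB (ma 0%N) (measurable_cst e))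
    (fun i => ma i.+1)) mb).
rewrite (band_integral_head m mg g0) (band_integral_head m mg')/=; last by move=> a b.
pose F (y : Rm) : \bar R := (\int[lebesgue_tuple m \x lebesgue_tuple m]_p
  (g (scons y (nth 0 p.1)) (nth 0 p.2))%:E)%E.
have := @ge0_integral_affine R 1 (- e) F ltr01.
rewrite invr1 mul1e => <-.
- by under [RHS]eq_integral do rewrite mul1r.
- pose G (q : Rm * (m.-tuple Rm * m.-tuple Rm)) : \bar R :=
    (g (scons q.1 (nth 0 q.2.1)) (nth 0 q.2.2))%:E.
  apply: (@measurable_integral_prod _ _ _ _ (lebesgue_tuple m) (lebesgue_tuple m)
    (fun y p => G (y, p))).
    apply/measurable_EFinP.
    have m21 := measurableT_comp measurable_fst (@measurable_snd _ _ Rm (m.-tuple Rm * m.-tuple Rm)%type).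
    have m22 := measurableT_comp measurable_snd (@measurable_snd _ _ Rm (m.-tuple Rm * m.-tuple Rm)%type).
    exact: (mg _ _ _ _ (scons_family measurable_fst (fun i => measurable_nth_comp i m21))
       (fun i => measurable_nth_comp i m22)).
  by move=> y p; rewrite lee_fin.
- by move=> y; apply: integral_ge0 => p _; rewrite lee_fin.
Qed.

End Tuples.

(** * The Laplace transform on the path *)
Section Closed.
Context {R : realType}.
Local Notation Rm := (measurableTypeR R).
Local Notation leb := (@lebesgue_measure R).
Implicit Types (a b s ta tb : nat -> R).

(** Real powers are measurable, and x^-1 = x (x^2)^(-1) also holds at 0. *)
Lemma measurable_inv : measurable_fun setT (fun x : Rm => x^-1 : Rm).
Proof.
rewrite [X in measurable_fun _ X](_ : _ = (fun x : Rm => x * (x ^+ 2) `^ (- 1))).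
  apply: measurable_funM => //.
  exact: (measurableT_comp (measurable_powR (- 1)) (measurable_funX 2 _)).
apply/funext => x; rewrite powR_inv1 ?sqr_ge0// expr2 invfM.
by have [->|x0] := eqVneq x 0; [rewrite invr0 mul0r|rewrite mulrA mulfV// mul1r].
Qed.

Lemma stream_measurable_tridet k : stream_measurable (R := R) (tridet k).
Proof.
suff H : stream_measurable (R := R) (tridet k) /\ stream_measurable (R := R) (tridet k.+1) by case: H.
elim: k => [|k [IH0 IH1]].
  by split=> d X a b ma mb; [exact: measurable_cst|exact: ma].
split=> // d X a b ma mb; under eq_fun do rewrite tridetSS.
apply: measurable_funB; apply: measurable_funM => //.
- exact: (IH1 _ _ _ _ (fun i => ma i.+1) (fun i => mb i.+1)).
- exact: measurable_funX.
- exact: (IH0 _ _ _ _ (fun i => ma i.+2) (fun i => mb i.+2)).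
Qed.

Lemma stream_measurable_det_ratio m : stream_measurable (R := R) (det_ratio m).
Proof.
move=> d X a b ma mb; apply: measurable_funM.
  exact: (stream_measurable_tridet _ ma mb).
apply: (measurableT_comp measurable_inv).
exact: (stream_measurable_tridet _ (fun i => ma i.+1) (fun i => mb i.+1)).
Qed.

Lemma measurable_band_pos k d (X : measurableType d) (a b : nat -> X -> R) :
  (forall i, measurable_fun setT (a i)) ->
  (forall i, measurable_fun setT (b i)) ->
  measurable_fun setT (fun x => band_pos k (a ^~ x) (b ^~ x)).
Proof.
elim: k a b => [|k IH] a b ma mb; first exact: measurable_cst.
under eq_fun do rewrite band_pos_suffix.
apply: measurable_and; first exact: (IH _ _ (fun i => ma i.+1) (fun i => mb i.+1)).
apply: measurable_fun_ltr; first exact: measurable_cst.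
exact: (stream_measurable_tridet _ ma mb).
Qed.

Lemma stream_measurable_band_weight c m s ta tb :
  stream_measurable (band_weight c m s ta tb).
Proof.
move=> d X a b ma mb; rewrite /band_weight; apply: measurable_fun_ifT.
- exact: measurable_band_pos.
- apply: measurable_funM.
    apply: measurableT_comp => //; apply: measurable_funN.
    apply: measurable_funD.
      by apply: measurable_sum => i; apply: measurable_funM.
    apply: measurable_funM => //.
    by apply: measurable_sum => i; apply: measurable_funM.
  apply: measurable_funM; first apply: measurable_funM.
  + apply: measurable_prod => i _; apply: (measurableT_comp (measurable_powR _)).
    exact: (stream_measurable_tridet _ ma mb).
  + apply: (measurableT_comp (measurable_powR _)).
    exact: (stream_measurable_tridet _ ma mb).
  + apply: measurable_prod => i _; apply: (measurableT_comp (measurable_powR _)).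
    exact: (stream_measurable_tridet _ (fun j => ma _) (fun j => mb _)).
- exact: measurable_cst.
Qed.

Lemma stream_measurable_ratio_weight (h : Rm -> R) m s ta tb :
  measurable_fun setT h -> stream_measurable (ratio_weight h m s ta tb).
Proof.
elim: m h s ta tb => [|m IH] h s ta tb mh d X a b ma mb /=.
  exact: (measurableT_comp mh (ma 0%N)).
apply: measurable_funM; first apply: measurable_funM.
- apply: (measurableT_comp mh).
  exact: (stream_measurable_det_ratio _ ma mb).
- apply: measurableT_comp => //; apply: measurable_funN.
  apply: measurable_funD; apply: measurable_funM => //.
    apply: measurable_funM; first exact: measurable_funX.
    apply: (measurableT_comp measurable_inv).
    exact: (stream_measurable_det_ratio _ (fun i => ma i.+1) (fun i => mb i.+1)).
  exact: measurable_funM.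
- exact: (IH _ _ _ _ (measurable_gamma_weight _ _) _ _ _ _
    (fun i => ma i.+1) (fun i => mb i.+1)).
Qed.

Lemma band_weight_ge0 c m s ta tb a b : 0 <= band_weight c m s ta tb a b.
Proof.
rewrite /band_weight; case: ifP => // _.
by rewrite mulr_ge0 ?expR_ge0// !mulr_ge0 ?powR_ge0 ?prodr_ge0// => i _;
  rewrite powR_ge0.
Qed.

Lemma ratio_weightE h m s ta tb a b : ratio_weight h m s ta tb a b =
  h (det_ratio m a b) * ratio_weight (cst 1) m s ta tb a b.
Proof.
by case: m => [|m] /=; rewrite ?mul1r ?mulr1 ?mulrA// /det_ratio tridet1 tridet0 divr1.
Qed.

(** Positivity of all the edge blocks, the natural domain of the Laplace
transform; it is weaker than positive definiteness. *)
Definition path_pos m ta tb := (forall i, (i <= m)%N -> 0 < ta i) /\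
  (forall i, (i < m)%N -> tb i ^+ 2 < ta i * ta i.+1).

Lemma path_pos_tail m ta tb : path_pos m.+1 ta tb -> path_pos m (tail ta) (tail tb).
Proof. by move=> [ta0 tb0]; split=> i im; [exact: ta0|exact: tb0]. Qed.

(** The factor that an edge contributes to the Laplace transform; u belongs to its
end farther from the root, v to the end closer to the root, and w to the edge
itself. *)
Definition edge_factor (e u v w : R) : R :=
  (u * v - w ^+ 2) `^ (- (e + 3 / 2)) * v `^ (e + 1).

Lemma edge_factorE e u v w : 0 < v -> w ^+ 2 < u * v ->
  v `^ (- 2^-1) * (u - w ^+ 2 / v) `^ (- (e + 2^-1 + 1)) = edge_factor e u v w.
Proof.
move=> v0 uv; have D0 : 0 <= u * v - w ^+ 2 by rewrite subr_ge0 ltW.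
rewrite (_ : u - _ = (u * v - w ^+ 2) * v^-1); last by field; exact: lt0r_neq0.
rewrite powRM ?invr_ge0 ?(ltW v0)// -[v^-1]powR_inv1 ?(ltW v0)// -powRrM.
rewrite mulrCA -powRD; last by rewrite lt0r_neq0 ?implybT.
by congr (_ `^ _ * _ `^ _); field.
Qed.

Lemma band_integral0 (g : (nat -> R) -> (nat -> R) -> R) (h : Rm -> R) :
  stream_measurable g -> (forall a b, 0 <= g a b) ->
  (forall a b, g a b = h (a 0%N)) ->
  band_integral 0 g = (\int[leb]_y (h y)%:E)%E.
Proof.
move=> mg g0 gh; rewrite band_integral_head//; apply: eq_integral => y _.
under eq_integral do rewrite gh /=.
rewrite integral_cst//= -setXTT product_measure1E//=.
by rewrite !diracT mul1e mule1.
Qed.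

Lemma gamma_weight_le0 (s t z : R) : z <= 0 -> gamma_weight s t z = 0 :> R.
Proof. by move=> z0; rewrite /gamma_weight ltNge z0. Qed.

Lemma measurable_gauss (u v : R) :
  measurable_fun setT (fun z : Rm => expR (- (u * z ^+ 2 + 2 * (v * z)))).
Proof.
apply: measurableT_comp => //; apply: measurable_funN; apply: measurable_funD.
  by apply: measurable_funM => //; exact: measurable_funX.
by apply: measurable_funM => //; exact: measurable_funM.
Qed.

(** The Gaussian integral over an edge variable turns a gamma weight of the pivot
q into another one: the power of q rises by 1/2 and the rate t becomes the
Schur complement t - be^2 / al. *)
Lemma integral_gauss_gamma (s t al be q : R) : 0 < al ->
  (\int[leb]_z (gamma_weight s t q * expR (- (al / q * z ^+ 2 + 2 * (be * z))))%:E =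
   (al `^ (- 2^-1) * gamma_weight (s + 2^-1) (t - be ^+ 2 / al) q)%:E * gauss_mass)%E.
Proof.
move=> al0; have [q0|q0] := ltP 0 q; last first.
  rewrite !gamma_weight_le0// mulr0 mul0e.
  by under eq_integral do rewrite mul0r; rewrite integral0.
rewrite ge0_integral_scale; first last.
- exact: gamma_weight_ge0.
- by move=> z; exact: expR_ge0.
- exact: measurable_gauss.
rewrite integral_gauss ?divr_gt0// muleA -EFinM; congr (_%:E * _)%E.
rewrite /gamma_weight q0.
rewrite powRM ?(ltW al0) ?invr_ge0 ?(ltW q0)// -[q^-1]powR_inv1 ?(ltW q0)// -powRrM.
rewrite mulrN mulN1r opprK [q `^ (s + _)]powRD ?lt0r_neq0 ?implybT//.
rewrite powR_inv1 ?(ltW q0)// -[in RHS](_ : expR (- (t * q)) * expR (be ^+ 2 / (al / q)) = expR _).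
  by ring.
by rewrite -expRD; congr expR; field; rewrite !lt0r_neq0.
Qed.

(** The integral over the first vertex and the first edge when the root is the
first vertex: a translation decouples y, then [integral_gauss_gamma] applies to
the next pivot q. *)
Lemma integral_edge_step (h : Rm -> R) (q al be s t k : R) :
  measurable_fun setT h -> (forall z, 0 <= h z) -> 0 < al -> 0 <= k ->
  (\int[leb]_z \int[leb]_y (h (y - z ^+ 2 / q) *
      expR (- (al * (z ^+ 2 / q) + 2 * (be * z))) * (gamma_weight s t q * k))%:E =
   (\int[leb]_y (h y)%:E) * gauss_mass *
   (al `^ (- 2^-1) * (gamma_weight (s + 2^-1) (t - be ^+ 2 / al) q * k))%:E)%E.
Proof.
move=> mh h0 al0 k0; set H := (\int[leb]_y (h y)%:E)%E.
have H0 : (0 <= H)%E by apply: integral_ge0 => y _ /=; rewrite lee_fin.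
pose E z := gamma_weight s t q * expR (- (al / q * z ^+ 2 + 2 * (be * z))).
have mE : measurable_fun setT (E : Rm -> R).
  by apply: measurable_funM => //; exact: measurable_gauss.
have E0 z : 0 <= E z by rewrite mulr_ge0 ?expR_ge0// gamma_weight_ge0.
transitivity (\int[leb]_z ((k * E z)%:E * H))%E.
  apply: eq_integral => z _.
  rewrite -[in RHS](_ : \int[leb]_y (h (1 * y + - (z ^+ 2 / q)))%:E = H)%E; last first.
    rewrite (@ge0_integral_affine _ _ (- (z ^+ 2 / q)) (EFin \o h)); first last.
    - by move=> y; rewrite lee_fin.
    - exact/measurable_EFinP.
    - exact: ltr01.
    by rewrite invr1 mul1e.
  rewrite -ge0_integral_scale//; first last.
  - by rewrite mulr_ge0.
  - apply: (@measurableT_comp _ _ _ _ _ _ h _ (fun y : Rm => 1 * y + - (z ^+ 2 / q)) mh).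
    by apply: measurable_funD => //; exact: measurable_funM.
  apply: eq_integral => y _; congr EFin.
  rewrite mul1r /E (_ : al / q * z ^+ 2 = al * (z ^+ 2 / q)); first by ring.
  by rewrite mulrAC mulrA.
rewrite ge0_integralZr//; first last.
- by move=> z _; rewrite lee_fin mulr_ge0.
- by apply/measurable_EFinP; exact: measurable_funM.
rewrite ge0_integral_scale// integral_gauss_gamma// muleA -EFinM.
rewrite [RHS]muleC [(H * _)%E]muleC muleA.
by congr (_%:E * _ * _)%E; rewrite mulrCA [k * _]mulrC.
Qed.

(** Recursion on the path rooted at its first vertex.  The weight of the first
pivot is arbitrary, and after one step the new first pivot has a gamma
weight. *)
Lemma band_integral_ratio_weight m s : exists2 C : \bar R, (0 <= C)%E &
  forall (h : Rm -> R) ta tb, measurable_fun setT h -> (forall z, 0 <= h z) ->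
  path_pos m ta tb ->
  (band_integral m (ratio_weight h m s ta tb) =
   (\int[leb]_y (h y)%:E) * C * (\prod_(i < m) edge_factor (s i.+1) (ta i.+1) (ta i) (tb i))%:E)%E.
Proof.
have gm0 u : (0 <= gamma_mass u :> \bar R)%E.
  by apply: integral_ge0 => z _; rewrite lee_fin gamma_weight_ge0.
have K0 : (0 <= gauss_mass :> \bar R)%E.
  by apply: integral_ge0 => z _; rewrite lee_fin expR_ge0.
elim: m s => [|m IH] s.
  exists 1%E => // h ta tb mh h0 _; rewrite big_ord0 !mule1.
  apply: (@band_integral0 (ratio_weight h 0 s ta tb) h) => //.
    by move=> *; apply: stream_measurable_ratio_weight.
  by move=> a b; exact: ratio_weight_ge0.
have [C C0 IHC] := IH (tail s).
exists (gauss_mass * gamma_mass (s 1%N + 2^-1) * C)%E; first by rewrite !mule_ge0.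
move=> h ta tb mh h0 pp; have [ta_gt0 tb_lt] := pp.
have ta0 : 0 < ta 0%N by exact: ta_gt0.
have D0 : 0 < ta 1%N - tb 0%N ^+ 2 / ta 0%N.
  by rewrite subr_gt0 ltr_pdivrMr// mulrC tb_lt.
rewrite band_integral_peel_inner; first last.
- by move=> a b; exact: ratio_weight_ge0.
- by move=> *; apply: stream_measurable_ratio_weight.
set H := (\int[leb]_y (h y)%:E)%E.
pose V := ratio_weight (gamma_weight (s 1%N + 2^-1) (ta 1%N - tb 0%N ^+ 2 / ta 0%N)) m
  (tail s) (tail ta) (tail tb).
have V0 a b : 0 <= V a b by apply: ratio_weight_ge0 => z; exact: gamma_weight_ge0.
transitivity (\int[lebesgue_tuple m.+1 \x lebesgue_tuple m]_p
  (H * gauss_mass * ((ta 0%N `^ (- 2^-1)) * V (nth 0%R p.1) (nth 0%R p.2))%:E))%E.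
  apply: eq_integral => -[a' b'] _ /=.
  set a := nth 0 a'; set b := nth 0 b'; set q := det_ratio m a b.
  set K := ratio_weight (cst 1) m (tail s) (tail ta) (tail tb) a b.
  have K1 : 0 <= K by exact: ratio_weight_ge0.
  have VE : V a b = gamma_weight (s 1%N + 2^-1) (ta 1%N - tb 0%N ^+ 2 / ta 0%N) q * K.
    by rewrite /V ratio_weightE.
  have gE : ratio_weight (gamma_weight (s 1%N) (ta 1%N)) m (tail s) (tail ta) (tail tb)
      a b = gamma_weight (s 1%N) (ta 1%N) q * K by rewrite ratio_weightE.
  under eq_integral do under eq_integral do
    rewrite (_ : tail (scons _ a) = a)// (_ : tail (scons _ b) = b)// gE -/q.
  have [q0|q0] := ltP 0 q; last first.
    have gw0 u v : gamma_weight u v q = 0 by rewrite /gamma_weight ltNge q0.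
    rewrite VE !gw0 mul0r mulr0 mule0.
    under eq_integral do under eq_integral do rewrite mulr0.
    by under eq_integral do rewrite integral0; rewrite integral0.
  have D1 : tridet m.+1 a b != 0.
    by apply: contraL q0 => /eqP D1; rewrite /q /det_ratio D1 mul0r ltxx.
  under eq_integral do under eq_integral do rewrite (det_ratio_rec (m := m))// -/q /=.
  by rewrite integral_edge_step// VE.
have mV : measurable_fun setT (fun p : m.+1.-tuple Rm * m.-tuple Rm =>
    V (nth 0 p.1) (nth 0 p.2)).
  have mV' : stream_measurable V.
    by move=> *; apply: stream_measurable_ratio_weight => //; exact: measurable_gamma_weight.
  exact: (mV' _ _ _ _ (fun i => measurable_nth_comp i measurable_fst)
    (fun i => measurable_nth_comp i measurable_snd)).
rewrite ge0_integralZl//; first last.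
- by rewrite mule_ge0// integral_ge0// => y _; rewrite lee_fin.
- by move=> p _; rewrite lee_fin mulr_ge0 ?powR_ge0.
- by apply/measurable_EFinP; exact: measurable_funM.
rewrite ge0_integral_scale ?powR_ge0// -/(band_integral m V).
rewrite (IHC _ _ _ _ _ (path_pos_tail pp)); first last.
- by move=> z; exact: gamma_weight_ge0.
- exact: measurable_gamma_weight.
rewrite integral_gamma// big_ord_recl -(edge_factorE (s 1%N) ta0); last first.
  by rewrite mulrC tb_lt.
rewrite !EFinM -!muleA; congr (_ * (_ * _))%E.
rewrite [(_ * (gamma_mass _ * _))%E]muleCA [(_ * (gamma_mass _ * _))%E]muleCA.
by congr (_ * _)%E; rewrite [(_ * (C * _))%E]muleCA [(_ * (C * _))%E]muleCA.
Qed.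

Definition band_laplace (c m : nat) s ta tb : R :=
  (\prod_(i < c) edge_factor (s i) (ta i) (ta i.+1) (tb i))
  * ta c `^ (- (s c + 1))
  * \prod_(i < m - c) edge_factor (s (c + i).+1)
      (ta (c + i).+1) (ta (c + i)%N) (tb (c + i)%N).

Lemma band_laplace_recl c m s ta tb : band_laplace c.+1 m.+1 s ta tb =
  edge_factor (s 0%N) (ta 0%N) (ta 1%N) (tb 0%N) *
  band_laplace c m (tail s) (tail ta) (tail tb).
Proof. by rewrite /band_laplace big_ord_recl subSS -!mulrA. Qed.

Lemma band_laplace_ge0 c m s ta tb : 0 <= band_laplace c m s ta tb.
Proof.
by rewrite !mulr_ge0 ?powR_ge0 ?prodr_ge0// => i _; rewrite mulr_ge0 ?powR_ge0.
Qed.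

Lemma band_integral_scale m (k : R) g : stream_measurable g ->
  (forall a b, 0 <= g a b) -> 0 <= k ->
  (band_integral m (fun a b => (k * g a b)%R) = k%:E * band_integral m g)%E.
Proof.
move=> mg g0 k0; rewrite /band_integral ge0_integral_scale//.
exact: (mg _ _ _ _ (fun i => measurable_nth_comp i measurable_fst)
    (fun i => measurable_nth_comp i measurable_snd)).
Qed.

(** The vertices before the root are eliminated one at a time; at the root the
previous lemma takes over.  The constant depends on s but not on theta. *)
Lemma band_integral_weight c m s : (c <= m)%N ->
  exists2 C : \bar R, (0 <= C)%E & forall ta tb, path_pos m ta tb ->
  (band_integral m (band_weight c m s ta tb) = C * (band_laplace c m s ta tb)%:E)%E.
Proof.
have gm0 u : (0 <= gamma_mass u :> \bar R)%E.
  by apply: integral_ge0 => z _; rewrite lee_fin gamma_weight_ge0.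
have K0 : (0 <= gauss_mass :> \bar R)%E.
  by apply: integral_ge0 => z _; rewrite lee_fin expR_ge0.
elim: c m s => [|c IH] m s cm.
  have [C C0 CE] := band_integral_ratio_weight m s.
  exists (gamma_mass (s 0%N) * C)%E; first by rewrite mule_ge0.
  move=> ta tb pp; have ta0 : 0 < ta 0%N by exact: pp.1.
  rewrite (_ : band_weight _ _ _ _ _ = ratio_weight (gamma_weight (s 0%N) (ta 0%N)) m s ta tb).
    rewrite CE//; [|exact: measurable_gamma_weight|by move=> z; exact: gamma_weight_ge0].
    rewrite integral_gamma// /band_laplace big_ord0 mul1r subn0 EFinM.
    by rewrite [RHS]muleA; congr (_ * _)%E; rewrite -muleA muleC.
  by apply/funext => a; apply/funext => b; exact: band_weight_root0.
case: m cm => // m cm; have {IH}[C C0 CE] := IH m (tail s) cm.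
exists (gauss_mass * gamma_mass (s 0%N + 2^-1) * C)%E; first by rewrite !mule_ge0.
move=> ta tb pp; have [ta_gt0 tb_lt] := pp.
have ta1 : 0 < ta 1%N by exact: ta_gt0.
have D0 : 0 < ta 0%N - tb 0%N ^+ 2 / ta 1%N.
  by rewrite subr_gt0 ltr_pdivrMr// tb_lt.
rewrite band_integral_peel; first last.
- by move=> a b; exact: band_weight_ge0.
- exact: stream_measurable_band_weight.
pose phi (y z : R) := gamma_weight (s 0%N) (ta 0%N) y *
  expR (- (ta 1%N / y * z ^+ 2 + 2 * (tb 0%N * z))).
have phi0 y z : 0 <= phi y z by rewrite mulr_ge0 ?expR_ge0// gamma_weight_ge0.
set X := (C * (band_laplace c m (tail s) (tail ta) (tail tb))%:E)%E.
have X0 : (0 <= X)%E by rewrite mule_ge0// lee_fin band_laplace_ge0.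
transitivity (\int[leb]_y ((ta 1%N `^ (- 2^-1) *
    gamma_weight (s 0%N + 2^-1) (ta 0%N - tb 0%N ^+ 2 / ta 1%N) y)%:E *
    gauss_mass * X))%E.
  apply: eq_integral => y _.
  transitivity (\int[leb]_z ((phi y z)%:E * X))%E.
    apply: eq_integral => z _.
    pose g := band_weight c m (tail s) (tail ta) (tail tb).
    have mg : stream_measurable g by exact: stream_measurable_band_weight.
    have g0 a b : 0 <= g a b by exact: band_weight_ge0.
    pose gs a b := g (scons (a 0%N - z ^+ 2 / y) (tail a)) b.
    have mgs : stream_measurable gs.
      move=> d Y a b ma mb; apply: (mg _ _ _ _ (scons_family
        (measurable_funB (ma 0%N) (measurable_cst (z ^+ 2 / y))) (fun i => ma i.+1)) mb).
    transitivity (band_integral m (fun a b => phi y z * gs a b)).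
      congr band_integral; apply/funext => a; apply/funext => b.
      rewrite band_weight_peel// /phi (_ : ta 1%N / y * z ^+ 2 = ta 1%N * (z ^+ 2 / y))//.
      by rewrite mulrAC mulrA.
    rewrite (band_integral_scale m mgs); first last.
    - exact: phi0.
    - by move=> a b; exact: g0.
    by rewrite band_integral_shift// CE//; exact: path_pos_tail.
  rewrite ge0_integralZr//; first last.
  - by move=> z _; rewrite lee_fin.
  - by apply/measurable_EFinP; apply: measurable_funM => //; exact: measurable_gauss.
  by rewrite integral_gauss_gamma.
have mw : measurable_fun setT (fun y : Rm => ta 1%N `^ (- 2^-1) *
    gamma_weight (s 0%N + 2^-1) (ta 0%N - tb 0%N ^+ 2 / ta 1%N) y).
  by apply: measurable_funM => //; exact: measurable_gamma_weight.
have w0 y : 0 <= ta 1%N `^ (- 2^-1) *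
    gamma_weight (s 0%N + 2^-1) (ta 0%N - tb 0%N ^+ 2 / ta 1%N) y.
  by rewrite mulr_ge0 ?powR_ge0 ?gamma_weight_ge0.
under eq_integral do rewrite -muleA.
rewrite ge0_integralZr//; first last.
- by rewrite mule_ge0.
- by move=> y _; rewrite lee_fin.
- exact/measurable_EFinP.
rewrite ge0_integral_scale ?powR_ge0//; first last.
- by move=> y; exact: gamma_weight_ge0.
- exact: measurable_gamma_weight.
rewrite integral_gamma// band_laplace_recl -edge_factorE//; last exact: tb_lt.
have ac (r e g K D T : \bar R) : (r * (e * g) * (K * (D * T)) = K * g * D * (r * e * T))%E.
  rewrite [(r * (e * g))%E]muleA [(K * (D * T))%E]muleA [(r * e * g)%E]muleC.
  by rewrite muleACA [(g * (K * D))%E]muleA [(g * K)%E]muleC.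
by rewrite /X !(EFinM (_ * _) (band_laplace _ _ _ _ _)) (EFinM (_ `^ _)); exact: ac.
Qed.
End Closed.

(** * Matrices of the path as pairs of streams *)
Section Tridiagonal.
Context {R : realType}.
Implicit Types (a b v : nat -> R).

Definition tri_mx k a b : 'M[R]_k := \matrix_(i, j)
  if i == j :> nat then a i else if i.+1 == j then b i
  else if j.+1 == i then b j else 0.

Lemma det_tri_mx k a b : \det (tri_mx k a b) = tridet k a b.
Proof.
suff H : \det (tri_mx k a b) = tridet k a b /\
    \det (tri_mx k.+1 a b) = tridet k.+1 a b by case: H.
elim: k a b => [|k IH] a b; first by rewrite det_mx00 det_mx11 mxE.
split; first by case: (IH a b).
have [IH0 IH1] : \det (tri_mx k (tail (tail a)) (tail (tail b))) =
    tridet k (tail (tail a)) (tail (tail b)) /\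
  \det (tri_mx k.+1 (tail a) (tail b)) = tridet k.+1 (tail a) (tail b).
  by split; [case: (IH (tail (tail a)) (tail (tail b)))|case: (IH (tail a) (tail b))].
rewrite tridetSS (expand_det_row _ ord0) !big_ord_recl big1 => [|j _]; last first.
  by rewrite !mxE /= mul0r.
rewrite !mxE /= addr0 /cofactor /= expr0 mul1r; congr (_ * _ + _).
  rewrite -IH1; congr (\det _); apply/matrixP => i j; rewrite !mxE /= /bump /=.
  by rewrite !add1n !eqSS.
rewrite (expand_det_col _ ord0) big_ord_recl big1 => [|j _]; last first.
  by rewrite !mxE /= mul0r.
rewrite !mxE /= addr0 /cofactor /= expr0 mul1r expr1 mulN1r mulrN expr2 -mulrA.
congr (- (_ * (_ * _))); rewrite -IH0; congr (\det _).
apply/matrixP => i j; rewrite !mxE /= /bump /= !add1n !eqSS.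
by rewrite /tail; case: ifP => // _; case: ifP.
Qed.

(** The quadratic form of the tridiagonal matrix. *)
Definition band_form k a b v : R :=
  if k is j.+1 then band_pairing j a b (fun i => v i ^+ 2) (fun i => v i * v i.+1) else 0.

Lemma band_formSS k a b v : band_form k.+2 a b v =
  a 0%N * v 0%N ^+ 2 + 2 * (b 0%N * (v 0%N * v 1%N)) +
  band_form k.+1 (tail a) (tail b) (tail v).
Proof. exact: band_pairing_recl. Qed.

Lemma band_form_schur k a b v : a 0%N != 0 -> band_form k.+2 a b v =
  a 0%N * (v 0%N + b 0%N * v 1%N / a 0%N) ^+ 2 +
  band_form k.+1 (schur a b) (tail b) (tail v).
Proof.
move=> a0; rewrite band_formSS.
have -> : band_form k.+1 (schur a b) (tail b) (tail v) =
    band_form k.+1 (tail a) (tail b) (tail v) - b 0%N ^+ 2 / a 0%N * v 1%N ^+ 2.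
  rewrite /band_form /band_pairing !big_ord_recl /= mulrBl -!addrA; congr (_ + _).
  by rewrite addrC -addrA.
by field.
Qed.

Definition band_form_pos k a b :=
  forall v, (exists2 i, (i < k)%N & v i != 0) -> 0 < band_form k a b v.

(** Completing the square in the first coordinate reduces the form to that of the
Schur complement. *)
Lemma band_posP k a b : band_form_pos k a b <-> band_pos k a b.
Proof.
elim: k a b => [|k IH] a b; first by split=> // _ v [].
split=> [H|/= /andP[a0 /IH H] v [i ik vi]].
  have a0 : 0 < a 0%N.
    have := H (scons 1 (fun=> 0)) (ex_intro2 _ _ 0%N isT _); rewrite /= oner_eq0 => /(_ isT).
    rewrite /band_pairing big_ord_recl/= !big1 => [|j _|j _]; last 2 first.
    - by rewrite mulr0 mulr0.
    - by rewrite expr2 !mulr0.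
    by rewrite expr1n mulr1 mulr0 !addr0.
  rewrite /= a0 /=; apply/IH => v [i ik vi].
  case: k IH H ik => // k IH H ik.
  (* the first coordinate that minimises the form *)
have := H (scons (- (b 0%N * v 0%N / a 0%N)) v) (ex_intro2 _ _ i.+1 ik vi).
  by rewrite band_form_schur ?lt0r_neq0//= addNr expr2 mulr0 mulr0 add0r.
case: k IH H ik => [|k] IH H ik.
  rewrite /= /band_pairing big_ord0 big_ord1 mulr0 addr0 mulr_gt0// exprn_even_gt0//=.
  by case: i ik vi.
have [[j jk vj]|v0] := pselect (exists2 j, (j < k.+1)%N & v j.+1 != 0).
  rewrite band_form_schur ?lt0r_neq0// ltr_wpDl ?H//; last by exists j.
  by rewrite mulr_ge0 ?sqr_ge0// ltW.
have vz j : (j < k.+1)%N -> v j.+1 = 0.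
  by move=> jk; apply/eqP/negPn/negP => vj; apply: v0; exists j.
have v00 : v 0%N != 0 by case: i ik vi => // i ik; rewrite vz// eqxx.
rewrite band_formSS (vz 0%N)// !mulr0 addr0 [X in _ + X](_ : _ = 0).
  by rewrite addr0 mulr_gt0// exprn_even_gt0//= v00.
rewrite /band_form /band_pairing !big1 ?mulr0 ?addr0// => j _.
- by rewrite /tail vz ?mul0r ?mulr0// ltnS ltnW.
- by rewrite /tail vz// expr2 !mulr0.
Qed.

Definition adjn (i j : nat) := (i <= j.+1)%N && (j <= i.+1)%N.

Lemma sum_adjn m (f : nat -> nat -> R) : (forall i j, f i j = f j i) ->
  \sum_(i < m.+1) \sum_(j < m.+1 | adjn i j) f i j =
  \sum_(i < m.+1) f i i + 2 * \sum_(i < m) f i i.+1.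
Proof.
elim: m f => [|m IH] f fC.
  by rewrite big_ord0 mulr0 addr0 !big_ord1_cond.
have row0 : \sum_(j < m.+2 | adjn 0 j) f 0%N j = f 0%N 0%N + f 0%N 1%N.
  by rewrite big_mkcond !big_ord_recl /= big1 ?addr0 // => j _; rewrite /adjn.
have col0 : \sum_(i < m.+1) (if adjn i.+1 0 then f i.+1 0%N else 0) = f 0%N 1%N.
  by rewrite big_ord_recl big1 ?addr0// => i _; rewrite /adjn andbC.
rewrite big_ord_recl row0.
have -> : \sum_(i < m.+1) \sum_(j < m.+2 | adjn (lift ord0 i) j) f (lift ord0 i) j =
    \sum_(i < m.+1) (if adjn i.+1 0 then f i.+1 0%N else 0) +
    \sum_(i < m.+1) \sum_(j < m.+1 | adjn i j) f i.+1 j.+1.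
  rewrite -big_split; apply: eq_bigr => i _.
  by rewrite big_mkcond big_ord_recl [in RHS]big_mkcond.
rewrite col0 (IH (fun i j => f i.+1 j.+1))//.
rewrite [in RHS]big_ord_recl [X in _ = _ + 2 * X]big_ord_recl /=.
by ring.
Qed.

End Tridiagonal.

Section Matrices.
Context {R : realType} {m : nat}.
Implicit Types (x y theta : 'M[R]_m.+1).

Definition diag_stream y (j : nat) : R := ent y j.+1 j.+1.
Definition off_stream y (j : nat) : R := ent y j.+1 j.+2.

Lemma entE y (i j : nat) (im : (i < m.+1)%N) (jm : (j < m.+1)%N) :
  ent y i.+1 j.+1 = y (Ordinal im) (Ordinal jm).
Proof. by rewrite /ent /= !insubT. Qed.

Lemma ent_ord y (i j : 'I_m.+1) : ent y i.+1 j.+1 = y i j.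
Proof. by case: i j => [i im] [j jm]; rewrite entE. Qed.

Lemma entC y i j : Z_G y -> ent y i j = ent y j i.
Proof.
move=> [yT _]; rewrite /ent; case: insubP => [a _ _|_]; case: insubP => //= b _ _.
by rewrite -[in LHS]yT mxE.
Qed.

Lemma pairingE x y : Z_G x -> Z_G y -> pairing x y =
  band_pairing m (diag_stream x) (off_stream x) (diag_stream y) (off_stream y).
Proof.
move=> Zx Zy; rewrite /band_pairing.
rewrite -(sum_adjn m (f := fun i j => ent x i.+1 j.+1 * ent y i.+1 j.+1)); last first.
  by move=> i j; rewrite !(entC j.+1).
by apply: eq_bigr => i _; apply: eq_bigr => j _; rewrite !ent_ord mulrC.
Qed.

Lemma blk_tri_mx y i k : Z_G y -> (i + k <= m.+1)%N ->
  blk y i.+1 k = tri_mx k (skip i (diag_stream y)) (skip i (off_stream y)).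
Proof.
move=> Zy ik; apply/matrixP => a b; rewrite !mxE.
case: (ltngtP a b) => [ab|ba|ab]; first 1 last.
- rewrite (entC _ _ Zy) (gtn_eqF (leqW ba)).
  case: eqVneq => [<-|ne]; first by rewrite /skip /off_stream !addnS addSn.
  have bi : (i + b < m.+1)%N by rewrite (leq_trans _ ik)// ltn_add2l.
  have ai : (i + a < m.+1)%N by rewrite (leq_trans _ ik)// ltn_add2l.
  rewrite !addSn entE// (proj2 Zy)// /adj /= -!addnS !leq_add2l negb_and.
  by rewrite -!ltnNge; apply/orP; right; rewrite ltn_neqAle ne.
- by rewrite ab /skip /diag_stream !addSn.
case: eqVneq => [<-|ne]; first by rewrite /skip /off_stream addSn !addnS.
rewrite (gtn_eqF (leqW ab)).
have bi : (i + b < m.+1)%N by rewrite (leq_trans _ ik)// ltn_add2l.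
have ai : (i + a < m.+1)%N by rewrite (leq_trans _ ik)// ltn_add2l.
rewrite !addSn entE// (proj2 Zy)// /adj /= -!addnS !leq_add2l negb_and.
by rewrite -!ltnNge; apply/orP; right; rewrite ltn_neqAle ne.
Qed.

Lemma det_blk y i k : Z_G y -> (i + k <= m.+1)%N ->
  \det (blk y i.+1 k) = tridet k (skip i (diag_stream y)) (skip i (off_stream y)).
Proof. by move=> Zy ik; rewrite blk_tri_mx// det_tri_mx. Qed.

Lemma blk_full y : blk y 1 m.+1 = y.
Proof. by apply/matrixP => i j; rewrite mxE !add1n ent_ord. Qed.

Lemma quadratic_form y (v : 'rV[R]_m.+1) : Z_G y ->
  (v *m y *m v^T) 0 0 =
  band_form m.+1 (diag_stream y) (off_stream y) (fun i => v 0 (inord i)).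
Proof.
move=> Zy; have [yT y0] := Zy.
pose f i j := ent y i.+1 j.+1 * (v 0 (inord i) * v 0 (inord j)).
have fC i j : f i j = f j i by rewrite /f (entC j.+1 _ Zy) [v _ _ * _]mulrC.
transitivity (\sum_(i < m.+1) \sum_(j < m.+1 | adjn i j) f i j).
  rewrite mxE; under eq_bigr do rewrite mxE mulr_suml.
  rewrite exchange_big/=; apply: eq_bigr => i _; rewrite [RHS]big_mkcond.
  apply: eq_bigr => j _; rewrite !mxE /f ent_ord !inord_val.
  case: ifPn => [_|/y0 ->]; first by rewrite mulrAC mulrC.
  by rewrite mulr0 mul0r.
by rewrite sum_adjn//; congr (_ + _); apply: eq_bigr => i _; rewrite /f -expr2.
Qed.

Lemma P_G_band_pos y : Z_G y -> P_G y <-> band_pos m.+1 (diag_stream y) (off_stream y).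
Proof.
move=> Zy; rewrite -band_posP; split=> [[_ H] v [i im vi]|H].
  pose u : 'rV[R]_m.+1 := \row_j v j.
  have := H u; rewrite quadratic_form// => Hu.
  have -> : band_form m.+1 (diag_stream y) (off_stream y) v =
      band_form m.+1 (diag_stream y) (off_stream y) (fun i => u 0 (inord i)).
    rewrite /band_form /band_pairing; congr (_ + 2 * _); apply: eq_bigr => j _.
      by rewrite mxE inordK.
    by rewrite !mxE !inordK// ltnS// ltnW.
  apply: Hu; apply/eqP => /rowP/(_ (Ordinal im)); rewrite !mxE => /eqP.
  by rewrite (negPf vi).
split=> // v v0; rewrite quadratic_form//; apply: H.
have [i vi] : exists i, v 0 i != 0.
  apply/existsP; rewrite -negb_forall; apply: contra v0 => /forallP v0.
  by apply/eqP/rowP => i; rewrite mxE; apply/eqP.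
by exists i; rewrite ?inord_val.
Qed.

Lemma DeltaE c (s : 'rV[R]_m.+1) y : Z_G y -> (c <= m)%N ->
  Delta c.+1 s y = band_Delta c m (fun j => sidx s j.+1) (diag_stream y) (off_stream y).
Proof.
move=> Zy cm; rewrite /Delta /band_Delta; congr (_ * _ * _).
- rewrite big_add1 big_mkord; apply: eq_bigr => i _; congr (_ `^ _).
  by rewrite det_blk// add0n (leq_trans (ltn_ord i)) ?(leq_trans cm).
- by rewrite -[in LHS](blk_full y) det_blk.
- rewrite -{1}[c.+2]add0n big_addn big_mkord.
  rewrite (_ : (m.+2 - c.+2 = m - c)%N)//; apply: eq_bigr => i _.
  rewrite (_ : (i + c.+2 = (c.+1 + i).+1)%N); last by rewrite addnC addSn.
  have im : (c.+1 + i <= m.+1)%N by rewrite addSn ltnS -leq_subRL// ltnW.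
  rewrite det_blk//; last by rewrite subSS subnKC.
  by rewrite subSS addSn subSS subnDA.
Qed.

Lemma band_mx_Z p : Z_G (@band_mx R m.+1 p).
Proof.
split=> [|i j ij]; first apply/matrixP => i j; rewrite !mxE.
  by rewrite eq_sym minnC /adj andbC; case: eqVneq => // ->.
have -> : (i == j) = false by apply: contraNF ij => /eqP ->; rewrite /adj leqnSn.
by rewrite (negPf ij).
Qed.

Lemma diag_stream_band p j : (j < m.+1)%N ->
  diag_stream (@band_mx R m.+1 p) j = nth 0 p.1 j.
Proof. by move=> jm; rewrite /diag_stream entE mxE eqxx (tnth_nth 0). Qed.

Lemma off_stream_band p j : (j < m)%N ->
  off_stream (@band_mx R m.+1 p) j = nth 0 p.2 j.
Proof.
move=> jm; have jm1 : (j < m.+1)%N by rewrite ltnS ltnW.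
rewrite /off_stream (entE _ jm1 (jm : (j.+1 < m.+1)%N)) mxE -val_eqE /= ltn_eqF//.
by rewrite /adj /= leqnn -addn2 leq_addr /= (minn_idPl _).
Qed.

End Matrices.

(** * Densities and measurability *)
Section Density.
Local Open Scope ereal_scope.
Context d (T : measurableType d) (R : realType).
Variables (mu nu : {measure set T -> \bar R}) (w : T -> R).
Hypotheses (mw : measurable_fun setT w) (w0 : forall x, (0 <= w x)%R).
Hypothesis mu_nu : forall A, measurable A -> mu A = \int[nu]_(x in A) (w x)%:E.

Import HBNNSimple.

Let integral_density_nnsfun (h : {nnsfun T >-> R}) :
  \int[mu]_x (h x)%:E = \int[nu]_x ((h x)%:E * (w x)%:E).
Proof.
have mi r : measurable_fun setT (fun x => (r * \1_(h @^-1` [set r]) x)%:E).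
  by apply/measurable_EFinP; exact: measurable_funM.
under [LHS]eq_integral do rewrite fimfunE -fsumEFin//.
rewrite [LHS]ge0_integral_fsum//; last by move=> n x _; exact: nnfun_muleindic_ge0.
transitivity (\int[nu]_x (\sum_(r \in range h)
    (r * \1_(h @^-1` [set r]) x)%:E * (w x)%:E)); last first.
  apply: eq_integral => x _; rewrite -ge0_mule_fsuml => [|y]; last exact: nnfun_muleindic_ge0.
  by rewrite fsumEFin// -fimfunE.
rewrite [RHS]ge0_integral_fsum//; last 2 first.
  - by move=> r; apply: emeasurable_funM => //; exact/measurable_EFinP.
  - by move=> r x _; apply: mule_ge0; [exact: nnfun_muleindic_ge0|rewrite lee_fin].
apply: eq_fsbigr => r rh; have r0 : (0 <= r)%R by move: rh; rewrite inE => -[t _ <-].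
under [RHS]eq_integral do rewrite EFinM -muleA.
rewrite integralZl_indic_nnsfun// ge0_integralZl//; last 2 first.
  - by apply: emeasurable_funM => //; exact/measurable_EFinP.
  - by move=> x _; rewrite mule_ge0 ?lee_fin.
congr (_ * _); rewrite integral_indic// setIT mu_nu// integral_mkcond.
by apply: eq_integral => x _; rewrite epatch_indic muleC.
Qed.

(** Monotone approximation by simple functions. *)
Lemma ge0_integral_density (f : T -> \bar R) : measurable_fun setT f ->
  (forall x, 0 <= f x) -> \int[mu]_x f x = \int[nu]_x (f x * (w x)%:E).
Proof.
move=> mf f0; pose f_ := nnsfun_approx measurableT mf.
transitivity (lim (\int[mu]_x (f_ n x)%:E @[n --> \oo])).
  rewrite -monotone_convergence//=.
  - apply: eq_integral => x _; apply/esym/cvg_lim => //=.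
    exact: cvg_nnsfun_approx.
  - by move=> n; exact/measurable_EFinP/measurable_funTS.
  - by move=> n x _; rewrite lee_fin.
  - by move=> x _ a b ab; rewrite lee_fin; exact/lefP/nd_nnsfun_approx.
transitivity (lim (\int[nu]_x ((f_ n x)%:E * (w x)%:E) @[n --> \oo])).
  by apply: congr_lim; apply/funext => n; exact: integral_density_nnsfun.
rewrite -monotone_convergence//=.
- apply: eq_integral => x _; apply/cvg_lim => //.
  by apply: cvgeZr => //; exact: cvg_nnsfun_approx.
- by move=> n; apply: emeasurable_funM; exact/measurable_EFinP.
- by move=> n x _; rewrite mule_ge0 ?lee_fin.
- move=> x _ a b ab; rewrite lee_wpmul2r ?lee_fin//; exact/lefP/nd_nnsfun_approx.
Qed.
End Density.

Section MatrixMeasurability.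
Context {R : realType} {m : nat}.
Implicit Types (theta x : 'M[R]_m.+1) (i j : nat).

Lemma measurable_mx_entry n p (a : 'I_n) (b : 'I_p) :
  measurable_fun setT (fun A : 'M[R]_(n, p) => A a b).
Proof.
move=> _ B mB; rewrite setTI; apply: sub_sigma_algebra.
by exists a => //; exists b => //; exists B => //; rewrite setTI.
Qed.

Lemma measurable_ent i j : measurable_fun setT (fun y : 'M[R]_m.+1 => ent y i j).
Proof.
rewrite /ent; case: insub => [a|]; last exact: measurable_cst.
case: insub => [b|]; last exact: measurable_cst.
exact: measurable_mx_entry.
Qed.

Lemma measurable_pairing theta : measurable_fun setT (fun y => pairing theta y).
Proof.
apply: measurable_sum => a; under eq_fun do rewrite big_mkcond.
apply: measurable_sum => b; case: (adj a b); last exact: measurable_cst.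
by apply: measurable_funM => //; exact: measurable_mx_entry.
Qed.

Lemma measurable_det_blk i k :
  measurable_fun setT (fun y : 'M[R]_m.+1 => \det (blk y i k)).
Proof.
apply: measurable_sum => s; apply: measurable_funM => //.
apply: measurable_prod => a _; under eq_fun do rewrite mxE.
exact: measurable_ent.
Qed.

Lemma measurable_Delta c (s : 'rV[R]_m.+1) : measurable_fun setT (Delta c s).
Proof.
apply: measurable_funM; first apply: measurable_funM.
- apply: measurable_prod => i _.
  exact: (measurableT_comp (measurable_powR _) (measurable_det_blk _ _)).
- apply: (measurableT_comp (measurable_powR _)).
  rewrite [X in measurable_fun _ X](_ : _ = (fun y : 'M[R]_m.+1 => \det (blk y 1 m.+1))).
    exact: measurable_det_blk.
  by apply/funext => y; rewrite blk_full.
- apply: measurable_prod => i _.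
  exact: (measurableT_comp (measurable_powR _) (measurable_det_blk _ _)).
Qed.

Lemma measurable_Z_G : measurable (Z_G : set 'M[R]_m.+1).
Proof.
have -> : (Z_G : set 'M[R]_m.+1) =
   \bigcap_(ij in [set: 'I_m.+1 * 'I_m.+1])
     ((fun y : 'M[R]_m.+1 => y ij.2 ij.1 - y ij.1 ij.2) @^-1` [set 0] `&`
      (fun y : 'M[R]_m.+1 => if adj ij.1 ij.2 then 0 else y ij.1 ij.2) @^-1` [set 0]).
  apply/seteqP; split=> [y [yT y0] [a b] _|y H].
    split=> /=; first by rewrite -{1}yT mxE subrr.
    by case: ifPn => // /y0.
  split=> [|a b ab].
    apply/matrixP => a b; rewrite mxE; have [/= /eqP + _] := H (a, b) I.
    by rewrite subr_eq0 => /eqP.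
  by have [_ /=] := H (a, b) I; rewrite (negPf ab).
apply: fin_bigcap_measurable => // -[a b] _.
have m0 : measurable ([set 0] : set R) by exact: measurable_set1.
apply: measurableI; rewrite -[X in measurable X]setTI.
  have mf : measurable_fun setT (fun y : 'M[R]_m.+1 => y b a - y a b).
    by apply: measurable_funB; exact: measurable_mx_entry.
  exact: mf.
have mf : measurable_fun setT (fun y : 'M[R]_m.+1 => if adj a b then 0 else y a b).
  by case: (adj a b); [exact: measurable_cst|exact: measurable_mx_entry].
exact: mf.
Qed.

Lemma P_GE : (P_G : set 'M[R]_m.+1) = Z_G `&`
  [set y | band_pos m.+1 (diag_stream y) (off_stream y)].
Proof.
apply/seteqP; split=> [y Py|y [Zy ty]]; last exact/(P_G_band_pos Zy).
by have Zy := Py.1; split => //; exact/(P_G_band_pos Zy).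
Qed.

Lemma measurable_P_G : measurable (P_G : set 'M[R]_m.+1).
Proof.
rewrite P_GE; apply: measurableI; first exact: measurable_Z_G.
have mt := @measurable_band_pos R m.+1 _ 'M[R]_m.+1 (fun j y => diag_stream y j)
  (fun j y => off_stream y j) (fun j => measurable_ent _ _) (fun j => measurable_ent _ _).
have mtrue : measurable ([set true] : set bool) by [].
by have := mt measurableT _ mtrue; rewrite setTI.
Qed.

End MatrixMeasurability.

(** * The Laplace transform of the Wishart law *)
Section WishartLaplace.
Context {R : realType} {m : nat}.
Local Notation Rm := (measurableTypeR R).
Implicit Types (theta x y : 'M[R]_m.+1) (s : 'rV[R]_m.+1).

Lemma ent_default y i j : (m < i)%N || (m < j)%N -> ent y i.+1 j.+1 = 0.
Proof.
move=> /orP[im|jm]; rewrite /ent /=; first by rewrite insubF// ltnNge im.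
by case: insub => // a; rewrite insubF// ltnNge jm.
Qed.

Lemma diag_stream_bandE p : diag_stream (@band_mx R m.+1 p) = nth 0 p.1.
Proof.
apply/funext => j; have [jm|jm] := ltnP j m.+1; first exact: diag_stream_band.
by rewrite nth_default ?size_tuple// /diag_stream ent_default// jm.
Qed.

Lemma off_stream_bandE p : off_stream (@band_mx R m.+1 p) = nth 0 p.2.
Proof.
apply/funext => j; have [jm|jm] := ltnP j m; first exact: off_stream_band.
by rewrite nth_default ?size_tuple// /off_stream ent_default// ltnS jm orbT.
Qed.

Lemma edge_factor_gt0 (e u v w : R) : 0 < v -> w ^+ 2 < u * v ->
  0 < edge_factor e u v w.
Proof. by move=> v0 uv; rewrite mulr_gt0// powR_gt0// subr_gt0. Qed.

(** Extended by 0 so that it is a density on the whole space. *)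
Definition wishart_weight c s theta : 'M[R]_m.+1 -> R :=
  (fun y => expR (- pairing theta y) * Delta c.+1 s y) \_ P_G.

Let weight_ge0 c s theta y : 0 <= expR (- pairing theta y) * Delta c.+1 s y.
Proof.
by rewrite !mulr_ge0 ?expR_ge0 ?powR_ge0 ?prodr_ge0// => i _; rewrite powR_ge0.
Qed.

Lemma measurable_wishart_weight c s theta :
  measurable_fun setT (wishart_weight c s theta).
Proof.
apply/(measurable_restrictT _ measurable_P_G)/measurable_funTS.
apply: measurable_funM; last exact: measurable_Delta.
by apply: measurableT_comp => //; apply: measurable_funN; exact: measurable_pairing.
Qed.

Lemma wishart_weight_ge0 c s theta y : 0 <= wishart_weight c s theta y.
Proof. by rewrite /wishart_weight patchE; case: ifP => // _; exact: weight_ge0. Qed.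

Lemma integral_wishart_weight c s theta : (c <= m)%N -> Z_G theta ->
  (\int[lebesgue_Z]_y (wishart_weight c s theta y)%:E =
   band_integral m (band_weight c m (fun j => sidx s j.+1)
     (diag_stream theta) (off_stream theta)))%E.
Proof.
move=> cm Zt; rewrite ge0_integral_pushforward; first last.
- by move=> y _; rewrite lee_fin wishart_weight_ge0.
- by apply/measurable_EFinP; exact: measurable_wishart_weight.
- exact: measurableT.
- exact: measurable_band_mx.
rewrite preimage_setT; apply: eq_integral => p _ /=; congr EFin.
have Zp := band_mx_Z p.
rewrite /wishart_weight patchE /band_weight.
rewrite -diag_stream_bandE -off_stream_bandE.
case: ifPn => [/set_mem/(P_G_band_pos Zp)->|/negP nP].
  by rewrite (pairingE Zt Zp) (DeltaE s Zp cm).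
by rewrite ifN//; apply/negP => /(P_G_band_pos Zp)/mem_set.
Qed.

Definition edge_pos theta := Z_G theta /\
  path_pos m (diag_stream theta) (off_stream theta).

Lemma pairingDl theta x y : pairing (theta + x) y = pairing theta y + pairing x y.
Proof.
rewrite /pairing -big_split; apply: eq_bigr => i _; rewrite -big_split.
by apply: eq_bigr => j _; rewrite mxE mulrDr.
Qed.

Lemma pairingZl (t : R) x y : pairing (t *: x) y = t * pairing x y.
Proof.
rewrite /pairing mulr_sumr; apply: eq_bigr => i _; rewrite mulr_sumr.
by apply: eq_bigr => j _; rewrite mxE mulrCA.
Qed.

Lemma pairingC x y : pairing x y = pairing y x.
Proof. by apply: eq_bigr => i _; apply: eq_bigr => j _; rewrite mulrC. Qed.

Lemma wishart_law_density c s theta (mu : probability 'M[R]_m.+1 R) :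
  wishart_law c.+1 s theta mu -> exists2 k : R, 0 < k &
  forall A, measurable A ->
    mu A = (\int[lebesgue_Z]_(y in A) (k * wishart_weight c s theta y)%:E)%E.
Proof.
move=> [k k0 muE]; exists k => // A mA; rewrite muE//.
rewrite [LHS](_ : _ = k%:E * \int[lebesgue_Z]_(y in A) (wishart_weight c s theta y)%:E)%E.
  under [RHS]eq_integral do rewrite EFinM.
  rewrite ge0_integralZl//; first last.
  - by rewrite lee_fin ltW.
  - by move=> y _; rewrite lee_fin wishart_weight_ge0.
  - by apply/measurable_EFinP/measurable_funTS; exact: measurable_wishart_weight.
congr (_ * _)%E; rewrite integral_mkcondr; apply: eq_integral => y _.
by rewrite /wishart_weight !patchE; case: ifP.
Qed.

(** The Laplace transform at theta - theta0 of the law with parameter theta0 is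
the unnormalised one at theta; its constant is identified at theta0, where the
transform is 1, which also shows that it is finite. *)
Lemma wishart_laplace c s theta0 (mu : probability 'M[R]_m.+1 R) :
  (c <= m)%N -> edge_pos theta0 -> wishart_law c.+1 s theta0 mu ->
  let L theta := band_laplace c m (fun j => sidx s j.+1)
    (diag_stream theta) (off_stream theta) in
  forall theta, edge_pos theta ->
  (\int[mu]_y (expR (- pairing (theta - theta0) y))%:E = (L theta / L theta0)%:E)%E.
Proof.
move=> cm t0 /wishart_law_density[k k0 muE] L.
have [C C0 CE] := band_integral_weight (fun j => sidx s j.+1) cm.
have intE theta : edge_pos theta ->
    (\int[mu]_y (expR (- pairing (theta - theta0) y))%:E = k%:E * C * (L theta)%:E)%E.
  move=> [Zt tp]; rewrite (ge0_integral_density _ _ muE); first last.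
  - by move=> y; rewrite lee_fin expR_ge0.
  - apply/measurable_EFinP; apply: measurableT_comp => //.
    by apply: measurable_funN; exact: measurable_pairing.
  - by move=> y; rewrite mulr_ge0 ?wishart_weight_ge0 ?ltW.
  - by apply: measurable_funM => //; exact: measurable_wishart_weight.
  rewrite -muleA -CE// -(integral_wishart_weight s cm Zt).
  rewrite -ge0_integralZl//; first last.
  - by rewrite lee_fin ltW.
  - by move=> y _; rewrite lee_fin wishart_weight_ge0.
  - by apply/measurable_EFinP; exact: measurable_wishart_weight.
  apply: eq_integral => y _; rewrite -!EFinM mulrCA; congr (_ * _)%:E.
  rewrite /wishart_weight !patchE; case: ifP => _; last by rewrite mulr0.
  rewrite mulrA -expRD -opprD; congr (expR (- _) * _).
  by rewrite -pairingDl subrK.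
have L0 theta : edge_pos theta -> 0 < L theta.
  move=> [_ [dp ep]]; rewrite /L /band_laplace; apply: mulr_gt0; first apply: mulr_gt0.
  - apply: prodr_gt0 => i _; have im := leq_trans (ltn_ord i) cm.
    by apply: edge_factor_gt0; [exact: dp|exact: ep].
  - by rewrite powR_gt0// dp.
  - apply: prodr_gt0 => i _; have im : (c + i < m)%N by rewrite -ltn_subRL.
    by apply: edge_factor_gt0; [exact/dp/ltnW|rewrite mulrC; exact: ep].
have p0 y : pairing (theta0 - theta0) y = 0.
  rewrite subrr /pairing big1// => i _; rewrite big1// => j _.
  by rewrite mxE mulr0.
have : (k%:E * C * (L theta0)%:E = 1)%E.
  rewrite -intE//; under eq_integral do rewrite p0 oppr0 expR0.
  by rewrite integral_cst//= mul1e probability_setT.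
have := L0 _ t0; move: intE; case: (k%:E * C)%E => [r|//|//] intE l0.
- move=> rlE theta tp; have rl : r * L theta0 = 1 by apply: EFin_inj; rewrite EFinM.
  rewrite intE// -EFinM; congr EFin.
  by rewrite -[r](mulfK (lt0r_neq0 l0)) rl mul1r mulrC.
- by rewrite gt0_mulye ?lte_fin.
- by rewrite gt0_mulNye ?lte_fin.
Qed.

Lemma band_pairing_ext ta tb a b a' b' : (forall j, (j <= m)%N -> a j = a' j) ->
  (forall j, (j < m)%N -> b j = b' j) ->
  band_pairing m ta tb a b = band_pairing m ta tb a' b' :> R.
Proof.
move=> aa bb; rewrite /band_pairing; congr (_ + 2 * _); apply: eq_bigr => j _.
  by rewrite aa// -ltnS.
by rewrite bb.
Qed.

Lemma sum_delta n (f : nat -> R) i (u : R) : (i < n)%N ->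
  \sum_(j < n) f j * (if j == i :> nat then u else 0) = f i * u.
Proof.
move=> im; rewrite (bigD1 (Ordinal im))//= eqxx big1 ?addr0// => j.
by rewrite -val_eqE /= => /negPf ->; rewrite mulr0.
Qed.

Lemma sum_delta0 n (f : nat -> R) i (u : R) : (n <= i)%N ->
  \sum_(j < n) f j * (if j == i :> nat then u else 0) = 0.
Proof.
move=> ni; rewrite big1// => j _; rewrite ltn_eqF ?mulr0//.
exact: leq_trans (ltn_ord j) ni.
Qed.

(** Edge positivity of Q_G is read off from the squares of vectors carried by an
edge, which are limits of positive definite matrices. *)
Section TestVectors.
Variables (i : nat) (al be : R).

Definition edge_vector (j : nat) : R :=
  (if j == i then al else 0) + (if j == i.+1 then be else 0).

Definition edge_square : 'M[R]_m.+1 := \matrix_(a, b) (edge_vector a * edge_vector b).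

Lemma edge_square_Z : Z_G edge_square.
Proof.
split=> [|a b]; first by apply/matrixP => a b; rewrite !mxE mulrC.
rewrite /adj mxE => ab.
have ev j : ~~ ((j == i) || (j == i.+1)) -> edge_vector j = 0.
  by rewrite negb_or /edge_vector => /andP[/negPf -> /negPf ->]; rewrite addr0.
have [aE|/ev->] := boolP ((a == i :> nat) || (a == i.+1 :> nat)); last by rewrite mul0r.
have [bE|/ev->] := boolP ((b == i :> nat) || (b == i.+1 :> nat)); last by rewrite mulr0.
lia.
Qed.

Lemma pairing_edge_square theta : Z_G theta -> (i <= m)%N -> (i < m)%N || (be == 0) ->
  pairing theta edge_square = diag_stream theta i * al ^+ 2 +
    2 * (off_stream theta i * (al * be)) + diag_stream theta i.+1 * be ^+ 2.
Proof.
have n1 : (i == i.+1) = false by lia.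
have n2 : (i.+1 == i) = false by lia.
move=> Zt im bm; rewrite (pairingE Zt edge_square_Z).
rewrite (@band_pairing_ext _ _ _ _
  (fun j => (if j == i then al ^+ 2 else 0) + (if j == i.+1 then be ^+ 2 else 0))
  (fun j => if j == i then al * be else 0)); first last.
- move=> j jm; rewrite /off_stream.
  rewrite (entE _ (ltnW jm : (j < m.+1)%N) (jm : (j.+1 < m.+1)%N)) mxE /= /edge_vector.
  rewrite eqSS; case: (eqVneq j i) => [->|ne].
    by rewrite n1 n2 add0r addr0.
  rewrite add0r addr0; case: eqVneq => [->|ne']; last by rewrite mul0r.
  by rewrite (_ : (i.+2 == i) = false) ?mulr0//; lia.
- move=> j jm; rewrite /diag_stream (entE _ (jm : (j < m.+1)%N) (jm : (j < m.+1)%N)) mxE /= /edge_vector.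
  case: (eqVneq j i) => [->|ne]; first by rewrite n1 !addr0 expr2.
  by rewrite !add0r; case: eqVneq => _; rewrite ?mulr0 ?expr2.
rewrite /band_pairing; under eq_bigr do rewrite mulrDr.
rewrite big_split /= sum_delta//.
have [im1|mi] := ltnP i m.
  by rewrite !sum_delta// addrAC.
move: bm; rewrite ltnNge mi /= => /eqP ->.
by rewrite !sum_delta0// ?expr2 ?mulr0 ?mulr0 ?addr0 ?mulr0 ?addr0.
Qed.

Lemma edge_square_closure : closure P_G edge_square.
Proof.
have qf v : 0 <= (v *m edge_square *m v^T) 0 0.
  pose u : 'rV[R]_m.+1 := \row_j edge_vector j.
  have -> : edge_square = u^T *m u.
    by apply/matrixP => a b; rewrite !mxE big_ord1 !mxE.
  rewrite mulmxA -mulmxA -[v *m u^T]trmxK trmx_mul trmxK.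
  rewrite mxE big_ord1 mxE -expr2 sqr_ge0//.
have Pt t : 0 < t -> P_G (edge_square + t *: 1%:M).
  move=> t0; split; first split.
  - by rewrite linearD linearZ /= trmx1 (edge_square_Z.1).
  - move=> a b ab; rewrite mxE (edge_square_Z.2 _ _ ab) !mxE.
    have -> : (a == b) = false by apply: contraNF ab => /eqP ->; rewrite /adj leqnSn.
    by rewrite mulr0 addr0.
  - move=> v v0; rewrite mulmxDr mulmxDl mxE ltr_wpDl// -scalemxAr mulmx1 -scalemxAl mxE.
    rewrite mulr_gt0// mxE; have [a va] : exists a, v 0 a != 0.
      apply/existsP; rewrite -negb_forall; apply: contra v0 => /forallP v0.
      by apply/eqP/rowP => a; rewrite mxE; apply/eqP.
    rewrite (bigD1 a)//= mxE ltr_pwDl//.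
      by rewrite -expr2 exprn_even_gt0//= va.
    by apply: sumr_ge0 => b _; rewrite mxE -expr2 sqr_ge0.
move=> B Bn.
have /nbhs_ballP[e /= e0 eB] := Bn.
exists (edge_square + (e / 2) *: 1%:M); split; first by apply: Pt; rewrite divr_gt0.
apply: eB; split=> // a b; rewrite /ball /= !mxE opprD addNKr normrN.
have e2 : e / 2 < e by rewrite ltr_pdivrMr// ltr_pMr// ltr1n.
case: (a == b); last by rewrite mulr0 normr0.
by rewrite mulr1 gtr0_norm ?divr_gt0.
Qed.

End TestVectors.

Lemma Q_G_edge_pos theta : Q_G theta -> edge_pos theta.
Proof.
move=> [Zt Ht]; split; first exact: Zt.
have Hp i al be : (i <= m)%N -> (i < m)%N || (be == 0) -> al != 0 ->
    0 < diag_stream theta i * al ^+ 2 +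
    2 * (off_stream theta i * (al * be)) + diag_stream theta i.+1 * be ^+ 2.
  move=> im bm al0; rewrite -pairing_edge_square//.
  apply: Ht; first exact: edge_square_closure.
  apply/eqP => /matrixP/(_ (Ordinal (im : (i < m.+1)%N)) (Ordinal (im : (i < m.+1)%N))).
  rewrite !mxE /edge_vector /= eqxx ltn_eqF// addr0 => /eqP.
  by rewrite mulf_eq0 orbb (negPf al0).
have d_gt0 i : (i <= m)%N -> 0 < diag_stream theta i.
  move=> im; have := Hp i 1 0 im; rewrite eqxx orbT => /(_ isT (oner_neq0 _)).
  by rewrite expr1n mulr1 !mulr0 expr2 !mulr0 !addr0.
split=> // i im.
have d1 := d_gt0 i.+1 im.
(* this vector minimises the form of the block, up to scale: the value is the
   determinant times the positive entry v *)
have := Hp i (diag_stream theta i.+1) (- off_stream theta i) (ltnW im).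
rewrite im => /(_ isT (lt0r_neq0 d1)).
set u := diag_stream theta i; set v := diag_stream theta i.+1; set w := off_stream theta i.
rewrite (_ : _ + _ = v * (u * v - w ^+ 2)); last by ring.
by rewrite pmulr_rgt0// subr_gt0.
Qed.

End WishartLaplace.

(** * The moments of the Wishart law *)
Section Openness.
Context {R : realType}.

Lemma pos_near (f : R -> R) a : is_derive (0 : R) (1 : R) f a -> 0 < f 0 ->
  exists2 e : R, 0 < e & forall t, `|t| <= e -> 0 < f t.
Proof.
move=> /der_continuous cf f0.
have /nbhs_ballP[e /= e0 He] : \forall t \near (0 : R), 0 < f t by exact: cvgr_gt cf _ f0.
exists (e / 2) => [|t te]; first by rewrite divr_gt0.
by apply: He; rewrite -ball_normE /= sub0r normrN (le_lt_trans te)// gtr_pMr// invf_lt1 ?ltr1n.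
Qed.

Lemma forall_near n (Q : nat -> R -> Prop) :
  (forall i, (i < n)%N -> exists2 e : R, 0 < e & forall t, `|t| <= e -> Q i t) ->
  exists2 e : R, 0 < e & forall t, `|t| <= e -> forall i, (i < n)%N -> Q i t.
Proof.
elim: n => [|n IH] H; first by exists 1.
have [e e0 He] := IH (fun i ik => H i (ltnW ik)).
have [f f0 Hf] := H n (ltnSn n).
exists (Num.min e f) => [|t]; first by rewrite lt_min e0.
rewrite le_min => /andP[te tf] i; rewrite ltnS leq_eqVlt => /orP[/eqP ->|ik].
  exact: Hf.
exact: He.
Qed.

Context {m : nat}.
Implicit Types (theta x : 'M[R]_m.+1).

Lemma ent_line theta (t : R) x i j :
  ent (theta + t *: x) i j = ent theta i j + t * ent x i j.
Proof.
rewrite /ent; case: insub => [a|]; last by rewrite mulr0 addr0.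
by case: insub => [b|]; rewrite ?mxE// mulr0 addr0.
Qed.

Lemma blk_line i k theta (t : R) x :
  blk (theta + t *: x) i k = blk theta i k + t *: blk x i k.
Proof. by apply/matrixP => a b; rewrite !mxE ent_line. Qed.

Lemma Z_G_line theta (t : R) x : Z_G theta -> Z_G x -> Z_G (theta + t *: x).
Proof.
move=> [tT t0] [xT x0]; split=> [|i j ij]; first by rewrite linearD linearZ /= tT xT.
by rewrite !mxE t0// x0// mulr0 addr0.
Qed.

Lemma edge_pos_open theta x : edge_pos theta -> Z_G x ->
  exists2 e : R, 0 < e & forall t, `|t| <= e -> edge_pos (theta + t *: x).
Proof.
move=> [Zt [dt ot]] Zx.
have de i j : is_derive (0 : R) (1 : R) (fun t : R => ent (theta + t *: x) i j) (ent x i j).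
  by under eq_fun do rewrite ent_line; exact: der_line.
have [e e0 He] : exists2 e : R, 0 < e & forall t, `|t| <= e ->
    forall i, (i < m.+1)%N -> 0 < diag_stream (theta + t *: x) i.
  apply: forall_near => i im; apply: pos_near (de _ _) _.
  by rewrite scale0r addr0; exact: dt.
have [f f0 Hf] : exists2 e : R, 0 < e & forall t, `|t| <= e ->
    forall i, (i < m)%N -> 0 < diag_stream (theta + t *: x) i *
      diag_stream (theta + t *: x) i.+1 - off_stream (theta + t *: x) i * off_stream (theta + t *: x) i.
  apply: forall_near => i im; rewrite /diag_stream /off_stream.
  apply: pos_near (derD (derM (de _ _) (de _ _)) (derN (derM (de _ _) (de _ _)))) _.
  by rewrite scale0r addr0 -expr2 subr_gt0; exact: ot.
exists (Num.min e f) => [|t]; first by rewrite lt_min e0.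
rewrite le_min => /andP[te tf]; split; first exact: Z_G_line.
split=> i im; first exact: He.
by rewrite -subr_gt0 expr2; exact: Hf.
Qed.

End Openness.

Section CycleWords.
Variables (N : nat) (s : 'S_N) (c : {set 'I_N}).
Hypothesis cs : c \in porbits s.

Lemma size_cycle_seq : size (cycle_seq s c) = #|c|.
Proof. by have [j _ ->] := cycle_seqE cs; rewrite size_traject. Qed.

Lemma prod_cycle_seq (R : comNzRingType) (f : 'I_N -> R) :
  \prod_(j <- cycle_seq s c) f j = \prod_(j in c) f j.
Proof.
have [j jc cE] := cycle_seqE cs.
have cj : c = porbit s j by apply/eqP; rewrite eq_sym -(porbits_memE _ cs).
rewrite -big_enum; apply: perm_big; apply: uniq_perm.
- by rewrite cE {1}cj uniq_traject_porbit.
- exact: enum_uniq.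
by move=> i; rewrite cE cj mem_enum porbit_traject.
Qed.

End CycleWords.

Section PathCumulants.
Context {R : realType} {m : nat}.
Implicit Types (theta x : 'M[R]_m.+1) (w : seq 'M[R]_m.+1) (s : nat -> R).

Definition blk_trace i k theta w : R :=
  \tr (\prod_(x <- w) (invmx (blk theta i k) *m blk x i k)).

Lemma blk_trace1 i theta w : ent theta i i != 0 ->
  blk_trace i 1 theta w = ent theta i i ^- size w * \prod_(x <- w) ent x i i.
Proof.
move=> e0.
have E x : invmx (blk theta i 1) *m blk x i 1 = ((ent theta i i)^-1 * ent x i i)%:M.
  have blkE y : blk y i 1 = (ent y i i)%:M.
    by apply/matrixP => a b; rewrite !mxE !ord1 eqxx addn0.
  by rewrite !blkE invmx_scalar -scalar_mxM.
rewrite /blk_trace; under eq_bigr do rewrite E.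
rewrite (_ : \prod_(x <- w) _ = (\prod_(x <- w) ((ent theta i i)^-1 * ent x i i))%:M); last first.
  elim: w => [|x w IH]; first by rewrite !big_nil.
  by rewrite !big_cons IH [RHS]scalar_mxM.
rewrite mxtrace_scalar mulr1n big_split/= big_const_seq count_predT; congr (_ * _).
by rewrite -exprVn; elim: (size w) => //= k ->; rewrite exprS.
Qed.

Lemma det_blk1 theta i : \det (blk theta i.+1 1) = diag_stream theta i.
Proof. by rewrite det_mx11 mxE addn0. Qed.

Lemma det_blk2 theta i : Z_G theta -> (i < m)%N -> \det (blk theta i.+1 2) =
  diag_stream theta i * diag_stream theta i.+1 - off_stream theta i ^+ 2.
Proof.
move=> Zt im; rewrite det_blk ?addn2//.
by rewrite tridetSS tridet1 tridet0 mulr1 /skip /tail addn0 addn1.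
Qed.

Lemma det_blk1_gt0 theta i : (i <= m)%N -> edge_pos theta ->
  0 < \det (blk theta i.+1 1).
Proof. by move=> im [_ [dt _]]; rewrite det_blk1 dt. Qed.

Lemma det_blk2_gt0 theta i : (i < m)%N -> edge_pos theta ->
  0 < \det (blk theta i.+1 2).
Proof. by move=> im [Zt [_ ot]]; rewrite det_blk2// subr_gt0 ot. Qed.

Lemma powR_invN (u a : R) : 0 < u -> u^-1 `^ a = u `^ (- a).
Proof. by move=> u0; rewrite -powR_inv1 ?ltW// -powRrM mulN1r. Qed.

(** The Laplace factor of the edge (i, i+1) and its cyclic cumulant; p is the end
of the edge closer to the root. *)
Definition edge_laplace (e : R) i p theta : R :=
  (\det (blk theta i.+1 2))^-1 `^ (e + 3 / 2) *
  (\det (blk theta p.+1 1))^-1 `^ (- (e + 1)).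

Definition edge_cumulant (e : R) i p theta w : R :=
  (e + 3 / 2) * blk_trace i.+1 2 theta w + - (e + 1) * blk_trace p.+1 1 theta w.

Lemma edge_cumulants (e : R) i p : (i < m)%N -> (p <= m)%N ->
  cumulants edge_pos (edge_laplace e i p) (edge_cumulant e i p).
Proof.
move=> im pm; apply: cumulantsM; apply: cumulants_powR; apply: cumulants_block.
- by move=> *; exact: blk_line.
- by move=> th; exact: det_blk2_gt0.
- by move=> *; exact: blk_line.
- by move=> th; exact: det_blk1_gt0.
Qed.

Lemma edge_laplaceE (e : R) i p theta : (i < m)%N -> (p <= m)%N -> edge_pos theta ->
  edge_laplace e i p theta =
  (diag_stream theta i * diag_stream theta i.+1 - off_stream theta i ^+ 2) `^ (- (e + 3 / 2))
  * diag_stream theta p `^ (e + 1).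
Proof.
move=> im pm tp; rewrite /edge_laplace !powR_invN ?det_blk1_gt0 ?det_blk2_gt0//.
by rewrite det_blk2 ?det_blk1 ?opprK//; case: tp.
Qed.

Definition path_laplace c s theta : R :=
  (\prod_(i < c) edge_laplace (s i) i i.+1 theta)
  * (\det (blk theta c.+1 1))^-1 `^ (s c + 1)
  * \prod_(i < m - c) edge_laplace (s (c + i).+1) (c + i) (c + i) theta.

Definition path_cumulant c s theta w : R :=
  \sum_(i < c) edge_cumulant (s i) i i.+1 theta w
  + (s c + 1) * blk_trace c.+1 1 theta w
  + \sum_(i < m - c) edge_cumulant (s (c + i).+1) (c + i) (c + i) theta w.

Lemma path_cumulants c s : (c <= m)%N ->
  cumulants edge_pos (path_laplace c s) (path_cumulant c s).
Proof.
move=> cm; apply: cumulantsM; first apply: cumulantsM.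
- apply: cumulants_prod => i; have ic := leq_trans (ltn_ord i) cm.
  exact: edge_cumulants.
- apply: cumulants_powR; apply: cumulants_block => [*|th]; first exact: blk_line.
  exact: det_blk1_gt0.
- apply: cumulants_prod => i; have im : (c + i < m)%N by rewrite -ltn_subRL.
  by apply: edge_cumulants => //; exact: ltnW.
Qed.

Lemma path_laplaceE c s theta : (c <= m)%N -> edge_pos theta ->
  path_laplace c s theta = band_laplace c m s (diag_stream theta) (off_stream theta).
Proof.
move=> cm tp; rewrite /path_laplace /band_laplace powR_invN ?det_blk1_gt0// det_blk1.
congr (_ * _ * _); apply: eq_bigr => i _.
  by have ic := leq_trans (ltn_ord i) cm; rewrite edge_laplaceE.
have im : (c + i < m)%N by rewrite -ltn_subRL.
by rewrite edge_laplaceE// 1?ltnW// /edge_factor mulrC [diag_stream _ _.+1 * _]mulrC mulrC.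
Qed.

(** The sums over vertices are shifted by one against the sums over edges, and
the terms at the root are collected.  When the root is an end of the path, the
missing edge is represented by the boundary value -1 of S, which gives it the
coefficient 0. *)
Lemma path_cumulant_bracket c (S T U : nat -> R) : (c <= m)%N ->
  S 0%N = -1 -> S m.+2 = -1 ->
  \sum_(i < c) ((S i.+1 + 3 / 2) * T i.+1 + - (S i.+1 + 1) * U i.+2)
  + (S c.+1 + 1) * U c.+1
  + \sum_(i < m - c) ((S (c + i).+2 + 3 / 2) * T (c + i).+1 +
                      - (S (c + i).+2 + 1) * U (c + i).+1)
  = \sum_(1 <= i < c.+1) (S i + 3 / 2) * T i
    + \sum_(c.+1 <= i < m.+1) (S i.+1 + 3 / 2) * T i
    - \sum_(2 <= i < c.+1) (S i.-1 + 1) * U i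
    - (S c - S c.+1 + S c.+2 + 1) * U c.+1
    - \sum_(c.+2 <= i < m.+1) (S i.+1 + 1) * U i.
Proof.
move=> cm S0 Sm; rewrite !big_split /=.
have shift (F : nat -> R) : \sum_(i < m - c) F (c + i)%N = \sum_(c <= i < m) F i.
  rewrite -[X in \sum_(X <= _ < _) _]add0n big_addn big_mkord.
  by apply: eq_bigr => i _; rewrite addnC.
have -> : \sum_(i < c) - (S i.+1 + 1) * U i.+2 =
    - (\sum_(2 <= i < c.+1) (S i.-1 + 1) * U i + (S c + 1) * U c.+1).
  under eq_bigr do rewrite mulNr; rewrite sumrN; congr (- _).
  rewrite big_add1 big_add1 /=; case: c {cm shift} => [|c]; last first.
    by rewrite big_ord_recr big_mkord.
  by rewrite big_ord0 big_geq// S0 addNr mul0r addr0.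
have -> : \sum_(i < m - c) - (S (c + i).+2 + 1) * U (c + i).+1 =
    - ((S c.+2 + 1) * U c.+1 + \sum_(c.+2 <= i < m.+1) (S i.+1 + 1) * U i).
  under eq_bigr do rewrite mulNr; rewrite sumrN; congr (- _).
  have [mc|mc] := ltnP c m; last first.
    have -> : c = m by apply/eqP; rewrite eqn_leq cm.
    by rewrite subnn big_ord0 big_geq// Sm addNr mul0r addr0.
  by rewrite (shift (fun i => (S i.+2 + 1) * U i.+1)) big_ltn// [in RHS]big_add1.
have -> : \sum_(1 <= i < c.+1) (S i + 3 / 2) * T i = \sum_(i < c) (S i.+1 + 3 / 2) * T i.+1.
  by rewrite big_add1 big_mkord.
rewrite (shift (fun i => (S i.+2 + 3 / 2) * T i.+1)) big_add1.
by ring.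
Qed.


Lemma path_moments c (s : 'rV[R]_m.+1) theta
    d (T : measurableType d) (P : probability T R) (Y : {RV P >-> 'M[R]_m.+1})
    N (x : 'I_N -> 'M[R]_m.+1) :
  (c <= m)%N -> edge_pos theta -> wishart_law c.+1 s theta (distribution P Y) ->
  (forall j, Z_G (x j)) ->
  (\int[P]_t (\prod_(j < N) pairing (Y t) (x j))%:E =
   (perm_sum (path_cumulant c (fun i => sidx s i.+1) theta) x)%:E)%E.
Proof.
move=> cm tp law Zx.
apply: (moment_perm_sum (X := fun y t => pairing (Y t) y)
  (path_cumulants (fun i => sidx s i.+1) cm) edge_pos_open tp) => //.
- move=> y; under eq_fun do rewrite pairingC.
  by apply: measurableT_comp => //; exact: measurable_pairing.
- by move=> y t z w; rewrite !(pairingC (Y w)) pairingDl pairingZl.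
move=> th tth; rewrite !path_laplaceE// -(wishart_laplace cm tp law tth).
have mE : measurable_fun setT (fun y => (expR (- pairing (th - theta) y))%:E).
  apply/measurable_EFinP; apply: measurableT_comp => //; apply: measurable_funN.
  exact: measurable_pairing.
rewrite (ge0_integral_distribution Y mE) => [|y]; last by rewrite lee_fin expR_ge0.
by apply: eq_integral => t _ /=; rewrite pairingC.
Qed.

End PathCumulants.

Theorem theorem8 (R : realType) (n M N : nat) (s : 'rV[R]_n)
    (theta : 'M[R]_n) (x : 'I_N -> 'M[R]_n)
    (d : measure_display) (T : measurableType d) (P : probability T R)
    (Y : {RV P >-> 'M[R]_n}) :
  (1 <= M <= n)%N ->
  (1 <= N)%N ->
  (forall i : nat, (1 <= i <= n)%N -> i != M -> - (3 / 2) < sidx s i) ->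
  - 1 < sidx s M ->
  Q_G theta ->
  (forall j, I_G (x j)) ->
  (forall t, P_G (Y t)) ->
  wishart_law M s theta (distribution P Y) ->
  ('E_P[fun t => (\prod_(j < N) pairing (Y t) (x j))%R] =
   (\sum_(pi : 'S_N) \prod_(c in porbits pi)
      (\sum_(1 <= i < M)
         (sidx s i + 3 / 2) *
         \tr (\prod_(j <- cycle_seq pi c)
                (invmx (blk theta i 2) *m blk (x j) i 2))
       + \sum_(M <= i < n)
         (sidx s i.+1 + 3 / 2) *
         \tr (\prod_(j <- cycle_seq pi c)
                (invmx (blk theta i 2) *m blk (x j) i 2))
       - \sum_(2 <= i < M)
         (sidx s i.-1 + 1) * ent theta i i ^- #|c| *
         \prod_(j in c) ent (x j) i i
       - (sidx s M.-1 - sidx s M + sidx s M.+1 + 1) *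
         ent theta M M ^- #|c| * \prod_(j in c) ent (x j) M M
       - \sum_(M.+1 <= i < n)
         (sidx s i.+1 + 1) * ent theta i i ^- #|c| *
         \prod_(j in c) ent (x j) i i))%:E)%E.
Proof.
case: n s theta x Y => [|m] s theta x Y; first by case: M.
case: M => [|c] //= ; rewrite ltnS => cm _ _ _ /Q_G_edge_pos tp Zx _ law.
rewrite unlock (path_moments cm tp law Zx); congr (_%:E).
apply: eq_bigr => pi _; apply: eq_bigr => b bpi.
pose w := [seq x j | j <- cycle_seq pi b].
have U_E i : (1 <= i <= m.+1)%N ->
    blk_trace i 1 theta w = ent theta i i ^- #|b| * \prod_(j in b) ent (x j) i i.
  case: i => // i /= im; rewrite blk_trace1; last first.
    by rewrite -/(diag_stream theta i) lt0r_neq0//; case: tp => _ [+ _]; exact.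
  by rewrite size_map size_cycle_seq// big_map prod_cycle_seq.
have T_E i : blk_trace i 2 theta w =
    \tr (\prod_(j <- cycle_seq pi b) (invmx (blk theta i 2) *m blk (x j) i 2)).
  by rewrite /blk_trace big_map.
rewrite /path_cumulant /edge_cumulant.
rewrite (path_cumulant_bracket (S := sidx s) (fun i => blk_trace i 2 theta w)
  (fun i => blk_trace i 1 theta w) cm)//; last by rewrite /= insubF// ltnn.
congr (_ + _ - _ - _ - _).
- by apply: eq_bigr => i _; rewrite T_E.
- by apply: eq_bigr => i _; rewrite T_E.
- apply: eq_big_nat => i /andP[i1 ic]; rewrite U_E ?mulrA//.
  by rewrite (ltnW i1) (leq_trans (ltnW ic)).
- by rewrite U_E ?mulrA.
- apply: eq_big_nat => i /andP[i1 im]; rewrite U_E ?mulrA//.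
  by rewrite (ltnW im) (leq_trans _ i1).
Qed.
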